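(* For $t\in[0,1]$ let $\Phi_t=\{\phi_1(x)=\frac x2,\phi_2(x)=\frac{x+1}2,\phi_3(x)=\frac{x+t}2,\phi_4(x)=\frac{x+1+t}2\}$ (attractor $[0,1+t]$), and for $z\in[0,1+t]$ and $h:\mathbb N\to[0,\infty)$ let $U_t(z,h)=\{x:|x-\phi_{\mathbf a}(z)|\le h(n)4^{-n}$ for some $\mathbf a\in\{1,2,3,4\}^n$, for infinitely many $n\}$. Then: 1. If $t\in\mathbb Q$, then $\Phi_t$ contains an exact overlap, and for every $z\in[0,1+t]$, $\dim_H U_t(z,1)<1$. 2. If $t\notin\mathbb Q$, there is $h:\mathbb N\to[0,\infty)$ (depending on the continued fraction expansion of $t$) with $h(n)\to0$ such that for every $z\in[0,1+t]$, Lebesgue-a.e. $x\in[0,1+t]$ lies in $U_t(z,h)$. 3. If $t$ is badly approximable, then for every $z\in[0,1+t]$ and every $h$ with $\sum_nh(n)=\infty$, Lebesgue-a.e. $x\in[0,1+t]$ lies in $U_t(z,h)$. 4. If $t\notin\mathbb Q$ is not badly approximable, there exists $h$ with $\sum_nh(n)=\infty$ such that $U_t(z,h)$ has zero Lebesgue measure for every $z\in[0,1+t]$. 5. If $t\notin\mathbb Q$ has continued fraction digits $(\zeta_m)$ and convergent denominators $(q_m)$ such that for every $\epsilon>0$ there is $L\in\mathbb N$ with $\sum_{1\le m\le M,\ q_{m+1}/q_m\ge L}\log_2(\zeta_{m+1}+1)\le\epsilon M$ for all sufficiently large $M$, then for every $z\in[0,1+t]$ and $h\in H^*$, Lebesgue-a.e.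 $x\in[0,1+t]$ lies in $U_t(z,h)$. 6. If $\mu$ is an ergodic invariant probability measure for the Gauss map with $\sum_{m\ge1}\mu([\frac1{m+1},\frac1m])\log_2(m+1)<\infty$, then for $\mu$-a.e. $t$, for every $z\in[0,1+t]$ and $h\in H^*$, Lebesgue-a.e. $x\in[0,1+t]$ lies in $U_t(z,h)$. In particular this holds for Lebesgue-a.e. $t\in[0,1]$.
   Context: $\phi_{\mathbf a}=\phi_{a_1}\circ\cdots\circ\phi_{a_n}$. An IFS contains an exact overlap if there are distinct words $\mathbf a\ne\mathbf b$ with $\phi_{\mathbf a}=\phi_{\mathbf b}$. For irrational $t\in[0,1]$, $t=[0;\zeta_1,\zeta_2,\ldots]$ is its continued fraction expansion, $p_m/q_m=[0;\zeta_1,\ldots,\zeta_m]$ its convergents; $t$ is badly approximable if $(\zeta_m)$ is bounded. Gauss map: $T(x)=1/x-\lfloor1/x\rfloor$. For $B\subseteq\mathbb N$, $\underline d(B)=\liminf_n\#(B\cap[1,n])/n$; $H^*_\epsilon=\{h:\mathbb N\to[0,\infty):\sum_{n\in B}h(n)=\infty$ for all $B$ with $\underline d(B)>1-\epsilon\}$ and $H^*=\bigcup_{\epsilon\in(0,1)}H^*_\epsilon$. *)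

(* Defs.v *)
From HB Require Import structures.
From mathcomp Require Import all_boot all_order all_algebra.
From mathcomp Require Import all_classical all_reals all_analysis.
Set Implicit Arguments. Unset Strict Implicit. Unset Printing Implicit Defensive.
Import Order.TTheory GRing.Theory Num.Theory.
Import numFieldNormedType.Exports.
Local Open Scope classical_set_scope.
Local Open Scope ring_scope.

Section Defs.
Variable R : realType.

Definition ifs_shift (t : R) (i : 'I_4) : R :=
  match val i with
  | 0%N => 0
  | 1%N => 1
  | 2%N => t
  | _ => 1 + t
  end.

Definition phi (t : R) (i : 'I_4) (x : R) : R := (x + ifs_shift t i) / 2.

Definition phi_word (t : R) (a : seq 'I_4) (x : R) : R :=
  foldr (fun i y => phi t i y) x a.

Definition exact_overlap (t : R) : Prop :=
  exists a b : seq 'I_4, a != b /\ (forall x, phi_word t a x = phi_word t b x).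

Definition U (t z : R) (h : nat -> R) : set R :=
  [set x | forall N : nat, exists2 n : nat, (N <= n)%N &
     exists a : n.-tuple 'I_4, `|x - phi_word t a z| <= h n * (4 ^- n)].

Definition is_rational (t : R) : Prop := exists r : rat, t = ratr r.

Definition diam (A : set R) : \bar R :=
  ereal_sup [set (`|p.1 - p.2|)%:E | p in A `*` A].

Definition hcost (s : R) (A : set R) : \bar R :=
  if pselect (A = set0) then 0%E else (powR (fine (diam A)) s)%:E.

Definition delta_cover (delta : R) (A : set R) (F : nat -> set R) : Prop :=
  A `<=` \bigcup_i F i /\ (forall i, (diam (F i) <= delta%:E)%E).

Definition hausdorff_content (s delta : R) (A : set R) : \bar R :=
  ereal_inf [set (\sum_(0 <= i <oo) hcost s (F i))%E | F in delta_cover delta A].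

Definition hausdorff_measure (s : R) (A : set R) : \bar R :=
  ereal_sup [set hausdorff_content s delta A | delta in [set d : R | 0 < d]].

Definition hausdorff_dim (A : set R) : \bar R :=
  ereal_inf [set s%:E | s in [set s : R | 0 <= s /\ hausdorff_measure s A = 0%E]].

Definition gauss (x : R) : R := x^-1 - (Num.floor (x^-1))%:~R.

Definition cf_digit (t : R) (m : nat) : nat :=
  if m is m'.+1 then Num.truncn ((iter m' gauss t)^-1) else 0%N.

(** (q_{m-1}, q_m) with q_{-1} = 0, q_0 = 1, q_m = zeta_m q_{m-1} + q_{m-2} *)
Fixpoint cf_qpair (t : R) (m : nat) : nat * nat :=
  if m is m'.+1 then
    let: (a, b) := cf_qpair t m' in (b, cf_digit t m * b + a)%N
  else (0%N, 1%N).

Definition cf_q (t : R) (m : nat) : nat := (cf_qpair t m).2.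

Definition badly_approximable (t : R) : Prop :=
  ~ is_rational t /\ exists C : nat, forall m, (cf_digit t m <= C)%N.

Definition log2 (x : R) : R := ln x / ln 2.

Definition lower_density (B : pred nat) : R :=
  limn_inf (fun n : nat => (count B (iota 1 n))%:R / n%:R).

Definition Hstar_eps (eps : R) (h : nat -> R) : Prop :=
  (forall n, 0 <= h n) /\
  forall B : pred nat, lower_density B > 1 - eps ->
    (\sum_(1 <= n <oo | B n) (h n)%:E)%E = +oo%E.

Definition Hstar (h : nat -> R) : Prop :=
  exists2 eps : R, 0 < eps < 1 & Hstar_eps eps h.

Definition ae_in_U (t z : R) (h : nat -> R) : Prop :=
  (@lebesgue_measure R).-negligible
    [set x | x \in `[0, 1 + t] /\ ~ U t z h x].

Definition good_param (t : R) : Prop :=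
  forall z, z \in `[0, 1 + t] -> forall h, Hstar h -> ae_in_U t z h.

(** mu is an invariant ergodic probability measure for the Gauss map,
    the Gauss map being defined on its domain (0,1] *)
Definition gauss_ergodic_invariant (mu : probability (measurableTypeR R) R) : Prop :=
  mu (`]0, 1]%classic) = 1%E /\
  (forall A : set R, measurable A ->
     mu [set x | 0 < x <= 1 /\ A (gauss x)] = mu A) /\
  (forall A : set R, measurable A ->
     (forall x, 0 < x <= 1 -> (A (gauss x) <-> A x)) ->
     mu A = 0%E \/ mu A = 1%E).

End Defs.

(* Main.v *)
(** The level-[n] points are [(z + j + k t) / 2^n] with [0 <= j, k < 2^n].

    For rational [t] only [O(2^n)] of them are distinct, and covering [U] by
    the corresponding balls of radius [4^-n] gives dimension at most 3/4. For
    irrational [t], whether they are [c / 4^n]-separated is read off the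
    continued fraction: [|k t - j| >= 1 / (2 q_m)] for [0 < k <= q_m / 2]. If
    all levels of a set [B] are separated with the same [c] and the sum of [h]
    over [B] diverges, then almost every point lies in [U]: in a small
    interval [I] one selects greedily, level by level, a fixed proportion of
    the points whose balls avoid all earlier balls; if the union stayed
    smaller than a fixed proportion of [I], the total length would diverge,
    and Lebesgue's density theorem concludes. Parts 2, 3 and 5 choose [B]
    suitably. For part 4, when [zeta_{m+1}] is large there is [n] with [q_m <<
    2^n << q_{m+1}], at which the points cluster, and [h] is supported on such
    levels.

    The digit condition of part 5 holds almost everywhere for a Gauss-invariant
    measure by the maximal ergodic inequality, and for
    Lebesgue measure by an exponential moment bound over continued fraction
    cylinders together with Borel-Cantelli. *)
Require Import Defs.
From HB Require Import structures.
From mathcomp Require Import all_boot all_order all_algebra.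
From mathcomp Require Import all_classical all_reals all_analysis.
From mathcomp Require Import measurable_realfun.
From mathcomp Require Import zify ring lra.
Import Order.TTheory GRing.Theory Num.Theory.
Import numFieldNormedType.Exports.
Local Open Scope classical_set_scope.
Local Open Scope ring_scope.

(** * Words and the lattice of level-n points *)

(** Balls of different levels are not independent, and no rate of equidistribution of [k t] is
    available, so divergence is used geometrically. A ball chosen earlier blocks, at level [n],
    about its length times [4 ^ n / c] points plus a bounded number, and the earlier balls number
    only a small fraction of [4 ^ n]. As long as little length is covered, most new points are free.
    The bounds scale with the interval, which is what a density argument needs. A large digit
    [zeta_{m+1}] spoils about [log2 zeta_{m+1}] consecutive levels: hence the logarithms in parts 5
    and 6. Lebesgue measure is not Gauss-invariant, so it needs an estimate of its own. *)

Fixpoint word_j (w : seq 'I_4) : nat :=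
  if w is i :: w' then (odd i * 2 ^ size w' + word_j w')%N else 0%N.

Fixpoint word_k (w : seq 'I_4) : nat :=
  if w is i :: w' then ((val i)./2 * 2 ^ size w' + word_k w')%N else 0%N.

Section Words.
Variable R : realType.
Implicit Types (t x z : R) (h : nat -> R).

(** The symbol [i] is a pair of bits: the low one contributes 1, the high one [t]. A word of length
    [n] is thus a pair of [n]-bit numbers, leading bit first, read off by [word_j] and [word_k]. *)
Lemma ifs_shiftE t (i : 'I_4) : ifs_shift t i = (odd i)%:R + ((val i)./2)%:R * t.
Proof.
by case: i => -[|[|[|[|//]]]] /= hi; rewrite /ifs_shift /= ?mul0r ?mul1r ?addr0 ?add0r.
Qed.

Lemma phi_wordE t w x :
  phi_word t w x = (x + (word_j w)%:R + (word_k w)%:R * t) / 2 ^+ size w.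
Proof.
elim: w x => [|i w IH] x /=; first by rewrite !addr0 mul0r addr0 expr0 divr1.
rewrite /phi IH ifs_shiftE !natrD !natrM !natrX exprS.
have h2 : 2 ^+ size w != 0 :> R by rewrite expf_neq0 // pnatr_eq0.
by field.
Qed.

Lemma word_j_lt w : (word_j w < 2 ^ size w)%N.
Proof.
elim: w => [//|i w IH] /=; rewrite expnS.
by case: (odd i) => /=; lia.
Qed.

Lemma word_k_lt w : (word_k w < 2 ^ size w)%N.
Proof.
elim: w => [//|i w IH] /=; rewrite expnS.
have : ((val i)./2 <= 1)%N by case: i => -[|[|[|[|//]]]].
by case: ((val i)./2) => [|[|//]] _; lia.
Qed.

Lemma word_of n j k : (j < 2 ^ n)%N -> (k < 2 ^ n)%N ->
  exists w : n.-tuple 'I_4, word_j w = j /\ word_k w = k.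
Proof.
elim: n j k => [|n IH] j k.
  rewrite expn0 !ltnS !leqn0 => /eqP -> /eqP ->.
  by exists [tuple].
rewrite expnS => hj hk.
pose bj := (2 ^ n <= j)%N; pose bk := (2 ^ n <= k)%N.
have h1 : (j - bj * 2 ^ n < 2 ^ n)%N by rewrite /bj; case: leqP; lia.
have h2 : (k - bk * 2 ^ n < 2 ^ n)%N by rewrite /bk; case: leqP; lia.
have [w [wj wk]] := IH _ _ h1 h2.
have hi : (bj + bk.*2 < 4)%N by case: (bj); case: (bk).
exists (cons_tuple (Ordinal hi) w) => /=.
rewrite wj wk size_tuple.
have -> : odd (bj + bk.*2) = bj by case: (bj); case: (bk).
have -> : (bj + bk.*2)./2 = bk by case: (bj); case: (bk).
by split; rewrite /bj /bk; case: leqP; lia.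
Qed.

Definition pt t z n (j k : nat) : R := (z + j%:R + k%:R * t) / 2 ^+ n.

Lemma U_ptP t z h x : U t z h x <-> forall N : nat, exists2 n, (N <= n)%N &
  exists j k : nat, [/\ (j < 2 ^ n)%N, (k < 2 ^ n)%N & `|x - pt t z n j k| <= h n / 4 ^+ n].
Proof.
split => hU N; have [n Nn] := hU N.
  move=> [a]; rewrite phi_wordE size_tuple => ha; exists n => //.
  have := word_j_lt a; have := word_k_lt a; rewrite size_tuple => h1 h2.
  by exists (word_j a), (word_k a); split.
move=> [j [k [hj hk hx]]]; exists n => //.
have [w [wj wk]] := word_of _ _ _ hj hk.
by exists w; rewrite phi_wordE size_tuple wj wk.
Qed.

Lemma rational_unitP t : t \in `[0, 1] -> is_rational t ->
  exists p q : nat, [/\ (0 < q)%N, (p <= q)%N & t = p%:R / q%:R].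
Proof.
rewrite in_itv /= => /andP[t0 t1] [r tr].
have hd : (0 < denq r)%R by exact: denq_gt0.
move: t0; rewrite tr ler0q => r0.
have nr : 0 <= numq r by rewrite numq_ge0.
have tE : t = (`|numq r|%N)%:R / (`|denq r|%N)%:R.
  by rewrite tr /ratr !natr_absz !ger0_norm // ltW.
have q0 : (0 < `|denq r|)%N by rewrite absz_gt0 denq_eq0.
exists `|numq r|%N, `|denq r|%N; split => //; last by rewrite -tr.
by move: t1; rewrite tE ler_pdivrMr ?ltr0n // mul1r ler_nat.
Qed.

(** With [t = p / q] the index pairs [(p, 0)] and [(0, q)] give the same map, as [q t = p]. Length
    [q] leaves room for both, since [p <= q < 2 ^ q]. *)
Lemma rational_exact_overlap t : t \in `[0, 1] -> is_rational t -> exact_overlap t.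
Proof.
move=> /rational_unitP H /H [p [q [q0 pq tE]]].
have hq : (q < 2 ^ q)%N by apply: ltn_expl.
have [a [aj ak]] := word_of q p 0 (leq_ltn_trans pq hq) ltac:(by rewrite expn_gt0).
have [b [bj bk]] := word_of q 0 q ltac:(by rewrite expn_gt0) hq.
exists a, b; split.
  by apply/eqP => ab; move: ak; rewrite ab bk; lia.
move=> x; rewrite !phi_wordE !size_tuple aj ak bj bk tE.
have q0' : (q%:R : R) != 0 by rewrite pnatr_eq0; lia.
by congr (_ / _); field.
Qed.

End Words.
Arguments pt {R}.

(** * Continued fractions *)

Section ContinuedFraction.
Variable R : realType.
Implicit Types (t x : R).

Lemma is_rational_int (n : int) : is_rational (n%:~R : R).
Proof. by exists n%:~R; rewrite ratr_int. Qed.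

Lemma gauss_rational x : is_rational (gauss x) -> is_rational x.
Proof.
move=> [r hr]; exists (r + (Num.floor x^-1)%:~R)^-1.
by rewrite fmorphV rmorphD /= ratr_int -hr /gauss subrK invrK.
Qed.

Lemma iter_gauss_rational t m : is_rational (iter m (@gauss R) t) -> is_rational t.
Proof. by elim: m => [//|m IH] /gauss_rational. Qed.

Lemma gauss_itv x : 0 <= gauss x < 1.
Proof.
by rewrite /gauss subr_ge0 ge_floor ltrBlDl addrC -[1]/(1%:~R) -intrD addrC; exact: floorD1_gt.
Qed.

Section Irrational.
Variable t : R.
Hypotheses (t01 : t \in `[0, 1]) (tirr : ~ is_rational t).

Let x m := iter m (@gauss R) t.

Lemma iter_gauss_itv m : 0 < iter m (@gauss R) t < 1.
Proof.
have xi n : iter m (@gauss R) t != n%:~R.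
  apply/eqP => hx; apply: tirr; apply: (@iter_gauss_rational _ m).
  by rewrite hx; exact: is_rational_int.
have : 0 <= iter m (@gauss R) t <= 1.
  case: (m) => [|m']; first by move: t01; rewrite in_itv.
  by have /andP[-> /ltW ->] := gauss_itv (iter m' (@gauss R) t).
by move=> /andP[h0 h1]; rewrite lt_neqAle h0 eq_sym (xi 0) lt_neqAle h1 (xi 1).
Qed.

Lemma iter_gauss_inv m : (x m)^-1 = (cf_digit t m.+1)%:R + x m.+1.
Proof.
have /andP[x0 x1] := iter_gauss_itv m.
rewrite [x m.+1]/(gauss (x m)) /gauss /= -/(x m).
have y0 : 0 <= (x m)^-1 by rewrite invr_ge0 ltW.
by rewrite truncn_floor y0 natr_absz ger0_norm ?floor_ge0 // addrC subrK.
Qed.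

Lemma cf_digit_gt0 m : (0 < cf_digit t m.+1)%N.
Proof.
have /andP[x0 x1] := iter_gauss_itv m.
by rewrite /= truncn_gt0 invf_ge1 ?ltW.
Qed.

(* (p_{m-1}, p_m), starting from (p_{-1}, p_0) = (1, 0). *)
Fixpoint cf_ppair (m : nat) : nat * nat :=
  if m is m'.+1 then
    let: (a, b) := cf_ppair m' in (b, cf_digit t m * b + a)%N
  else (1%N, 0%N).

Definition cf_p m := (cf_ppair m).2.

Lemma cf_qpairS1 m : (cf_qpair t m.+1).1 = cf_q t m.
Proof. by rewrite /cf_q /=; case: (cf_qpair t m). Qed.

Lemma cf_ppairS1 m : (cf_ppair m.+1).1 = cf_p m.
Proof. by rewrite /cf_p /=; case: (cf_ppair m). Qed.

Lemma cf_qS m : cf_q t m.+1 = (cf_digit t m.+1 * cf_q t m + (cf_qpair t m).1)%N.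
Proof. by rewrite /cf_q [cf_qpair t m.+1]/=; case: (cf_qpair t m). Qed.

Lemma cf_pS m : cf_p m.+1 = (cf_digit t m.+1 * cf_p m + (cf_ppair m).1)%N.
Proof. by rewrite /cf_p [cf_ppair m.+1]/=; case: (cf_ppair m). Qed.

Lemma cf_qSS m : cf_q t m.+2 = (cf_digit t m.+2 * cf_q t m.+1 + cf_q t m)%N.
Proof. by rewrite cf_qS cf_qpairS1. Qed.

Lemma cf_q_gt0 m : (0 < cf_q t m)%N.
Proof.
elim: m => [//|m IH]; rewrite cf_qS.
by have := cf_digit_gt0 m; lia.
Qed.

Lemma cf_q_ge_digit m : (cf_digit t m.+1 * cf_q t m <= cf_q t m.+1)%N.
Proof. by rewrite cf_qS leq_addr. Qed.

Lemma cf_q_leS m : (cf_q t m <= cf_q t m.+1)%N.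
Proof. by have := cf_q_ge_digit m; have := cf_digit_gt0 m; nia. Qed.

Lemma cf_q_mono m n : (m <= n)%N -> (cf_q t m <= cf_q t n)%N.
Proof.
move=> /subnK <-; elim: (n - m)%N => [//|d IH].
by rewrite addSn; exact: leq_trans IH (cf_q_leS _).
Qed.

Lemma cf_qpair1_le m : ((cf_qpair t m).1 <= cf_q t m)%N.
Proof. by case: m => [//|m]; rewrite cf_qpairS1 cf_q_leS. Qed.

Lemma cf_q_le_digit m : (cf_q t m.+1 <= (cf_digit t m.+1).+1 * cf_q t m)%N.
Proof. by rewrite cf_qS mulSn addnC leq_add2r cf_qpair1_le. Qed.

Lemma cf_q_double m : (2 * cf_q t m <= cf_q t m.+2)%N.
Proof.
rewrite cf_qSS.
by have := cf_q_leS m; have := cf_digit_gt0 m.+1; nia.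
Qed.

Lemma cf_q_expn m : (2 ^ m <= cf_q t m.*2)%N.
Proof.
elim: m => [//|m IH]; rewrite doubleS expnS.
exact: leq_trans (leq_mul (leqnn 2) IH) (cf_q_double _).
Qed.

(** The denominators at least double every two steps, so [m] is at most linear in the level. This
    converts averages over [m <= M] into averages over levels. *)
Lemma leq_expn_cf_q m n : (cf_q t m <= 2 ^ n)%N -> (m <= n.*2.+1)%N.
Proof.
move=> h; rewrite leqNgt; apply/negP => nm.
have : (cf_q t n.+1.*2 <= 2 ^ n)%N by apply: leq_trans h; apply: cf_q_mono; lia.
have n0 : (0 < 2 ^ n)%N by rewrite expn_gt0.
by have := cf_q_expn n.+1; rewrite expnS; lia.
Qed.

(** Put [D_m = q_m t - p_m] and let [zeta] be the next digit. Then [D_{m+1} = zeta D_m + D_{m-1}],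
    where [zeta = 1 / x_m - x_{m+1}] and, by induction, [D_{m-1} = - D_m / x_m]. *)
Lemma cf_D_rec m : (cf_q t m)%:R * t - (cf_p m)%:R =
  - x m * ((cf_qpair t m).1%:R * t - (cf_ppair m).1%:R).
Proof.
elim: m => [|m IH].
  by rewrite /cf_q /cf_p /x /=; ring.
rewrite cf_qS cf_pS cf_qpairS1 cf_ppairS1 !natrD !natrM.
have /andP[x0 _] := iter_gauss_itv m; rewrite -/(x m) in x0.
have dE : (cf_digit t m.+1)%:R = (x m)^-1 - x m.+1 by rewrite iter_gauss_inv addrK.
have D' : (cf_qpair t m).1%:R * t - (cf_ppair m).1%:R = - (x m)^-1 * ((cf_q t m)%:R * t - (cf_p m)%:R).
  by rewrite IH mulrA mulNr mulrN opprK mulVf ?mul1r // gt_eqF.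
rewrite dE (_ : _ - _ = ((x m)^-1 - x m.+1) * ((cf_q t m)%:R * t - (cf_p m)%:R)
  + ((cf_qpair t m).1%:R * t - (cf_ppair m).1%:R)); last by ring.
by rewrite D'; ring.
Qed.

Lemma cf_det m : ((cf_q t m)%:Z * (cf_ppair m).1%:Z - (cf_p m)%:Z * (cf_qpair t m).1%:Z = (-1) ^+ m)%R.
Proof.
elim: m => [|m IH]; first by rewrite /cf_q /cf_p.
rewrite cf_qpairS1 cf_ppairS1 cf_qS cf_pS exprS -IH !PoszD !PoszM; ring.
Qed.

Lemma cf_coprime m : coprime (cf_p m) (cf_q t m).
Proof.
have := cf_det m; move: (cf_q t m) (cf_p m) => q p hd.
have : (gcdn p q %| 1)%N; last by rewrite dvdn1.
have : ((gcdn p q)%:Z %| (-1) ^+ m)%Z.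
  have gp : ((gcdn p q)%:Z %| p%:Z)%Z by rewrite dvdzE dvdn_gcdl.
  have gq : ((gcdn p q)%:Z %| q%:Z)%Z by rewrite dvdzE dvdn_gcdr.
  by rewrite -hd; apply: rpredB; exact: dvdz_mulr.
by rewrite dvdzE abszX exp1n.
Qed.

(** Inserting [cf_D_rec] into the determinant identity at [m + 1] gives [(q_{m+1} + q_m x_{m+1})
    |q_m t - p_m| = 1]. *)
Lemma cf_approx m : `|(cf_q t m)%:R * t - (cf_p m)%:R| <= ((cf_q t m.+1)%:R)^-1.
Proof.
have := cf_D_rec m.+1; have := cf_det m.+1.
rewrite cf_qpairS1 cf_ppairS1.
move=> /(congr1 (intr : int -> R)).
rewrite rmorphB !rmorphM rmorphXn rmorphN1 /= => hd.
set D := (cf_q t m)%:R * t - (cf_p m)%:R => hD.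
have /andP[x0 _] := iter_gauss_itv m.+1; rewrite -/(x _) in x0.
have q0 : 0 < (cf_q t m.+1)%:R :> R by rewrite ltr0n cf_q_gt0.
have hE : ((cf_q t m.+1)%:R + (cf_q t m)%:R * x m.+1) * D = - (-1) ^+ m.+1.
  rewrite -hd (_ : - _ = (cf_q t m.+1)%:R * D - (cf_q t m)%:R * ((cf_q t m.+1)%:R * t - (cf_p m.+1)%:R)).
    by rewrite hD -[gauss (x m)]/(x m.+1); ring.
  by rewrite /D -!pmulrn; ring.
have hN : `|((cf_q t m.+1)%:R + (cf_q t m)%:R * x m.+1) * D| = 1.
  by rewrite hE normrN normrX normrN1 expr1n.
have hq : (cf_q t m.+1)%:R * `|D| <= 1.
  rewrite -[leRHS]hN normrM; apply: ler_wpM2r => //.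
  have hs : 0 <= (cf_q t m)%:R * x m.+1 by rewrite mulr_ge0 // ltW.
  have hs' := addr_ge0 (ltW q0) hs.
  by rewrite (ger0_norm hs') lerDl.
by rewrite -(ler_pM2l q0) mulfV ?gt_eqF.
Qed.

(** [k p_m - j q_m] is a nonzero integer, because [q_m] is prime to [p_m] and too large to divide
    [k]. Replacing [p_m] by [q_m t] changes it by at most [k / q_m <= 1 / 2], so
    [q_m |k t - j| >= 1 / 2]. *)
Lemma cf_lower m (k : nat) (j : int) : (0 < k)%N -> (2 * k <= cf_q t m)%N ->
  (2 * (cf_q t m)%:R)^-1 <= `|k%:R * t - j%:~R|.
Proof.
move=> k0 kq.
have q0 : 0 < (cf_q t m)%:R :> R by rewrite ltr0n cf_q_gt0.
have nz : ((k * cf_p m)%N%:Z - j * (cf_q t m)%:Z)%R != 0.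
  apply/eqP => /eqP; rewrite subr_eq0 => /eqP hE.
  have : (cf_q t m %| k * cf_p m)%N.
    by have : ((cf_q t m)%:Z %| (k * cf_p m)%N%:Z)%Z by rewrite hE dvdz_mull.
  rewrite Gauss_dvdl; last by rewrite coprime_sym cf_coprime.
  by move/(dvdn_leq k0); lia.
have h1 : (1 : R) <= `|k%:R * (cf_p m)%:R - j%:~R * (cf_q t m)%:R|.
  have : 1 <= `|((k * cf_p m)%N%:Z - j * (cf_q t m)%:Z)%R| by rewrite -gtz0_ge1 normr_gt0.
  by rewrite -(ler_int R) intr_norm rmorphB /= -!pmulrn natrM intrM -pmulrn.
have hD : `|(cf_q t m)%:R * t - (cf_p m)%:R| <= ((cf_q t m)%:R)^-1.
  apply: le_trans (cf_approx m) _; rewrite lef_pV2 ?posrE ?ltr0n ?cf_q_gt0 //.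
  by rewrite ler_nat cf_q_leS.
have : 1 <= (cf_q t m)%:R * `|k%:R * t - j%:~R| + 2^-1.
  apply: le_trans h1 _.
  rewrite (_ : _ - _ = (cf_q t m)%:R * (k%:R * t - j%:~R) - k%:R * ((cf_q t m)%:R * t - (cf_p m)%:R)); last by ring.
  apply: le_trans (ler_normB _ _) _; rewrite !normrM !normr_nat lerD2l.
  apply: le_trans (ler_wpM2l (ler0n _ _) hD) _.
  rewrite ler_pdivrMr // mulrC ler_pdivlMr // -natrM ler_nat mulnC //.
move=> h; rewrite invfM ler_pdivrMr //.
by move: h; rewrite [in X in X -> _]mulrC; lra.
Qed.

End Irrational.
End ContinuedFraction.

(** * Greedy selection of disjoint balls *)

Section Greedy.
Variable R : realType.
Local Notation mu := (@lebesgue_measure R).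

Lemma separated_size (s : seq R) (a b d : R) : 0 < d ->
  pairwise (fun p q => d <= `|p - q|) s -> {in s, forall p, a <= p <= b} ->
  a <= b -> (size s)%:R <= (b - a) / d + 1.
Proof.
move=> d0 sep sab ab.
pose f p := Num.truncn ((p - a) / d).
have fge p : p \in s -> 0 <= (p - a) / d.
  by move=> /sab /andP[ap _]; rewrite divr_ge0 ?subr_ge0 // ltW.
have u : uniq (map f s).
  rewrite uniq_pairwise pairwise_map; apply: sub_in_pairwise sep => // p q ps qs /= dpq.
  apply/eqP => fpq.
  have /andP[p1 p2] := truncn_itv (fge _ ps).
  have /andP[q1 q2] := truncn_itv (fge _ qs).
  rewrite -/(f p) in p1 p2; rewrite -/(f q) in q1 q2.
  rewrite fpq in p1 p2; rewrite -!natr1 in p2 q2.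
  have : `|(p - a) / d - (q - a) / d| < 1 by rewrite ltr_norml; apply/andP; split; lra.
  rewrite -mulrBl (_ : _ - a - _ = p - q); last by ring.
  by rewrite normrM normfV (gtr0_norm d0) ltr_pdivrMr // mul1r ltNge dpq.
have sub : {subset map f s <= iota 0 (Num.truncn ((b - a) / d)).+1}.
  move=> k /mapP[p ps ->]; rewrite mem_iota /= add0n ltnS /f.
  apply: le_truncn; rewrite ler_pM2r ?invr_gt0 // lerD2r.
  by have /andP[] := sab _ ps.
have := uniq_leq_size u sub; rewrite size_map size_iota => hs.
have : 0 <= (b - a) / d by rewrite divr_ge0 ?subr_ge0 // ltW.
rewrite -truncn_le => h; apply: le_trans (_ : (Num.truncn ((b - a) / d)).+1%:R <= _).
  by rewrite ler_nat.
by rewrite -natr1 lerD2r.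
Qed.

Lemma count_has_le (T S : Type) (Q : T -> S -> bool) (s : seq T) (l : seq S) :
  (count (fun p => has (Q p) l) s <= \sum_(J <- l) count (Q^~ J) s)%N.
Proof.
elim: l => [|J l IH] /=; first by rewrite big_nil count_pred0.
rewrite big_cons; apply: leq_trans (leq_add (leqnn _) IH).
by rewrite -count_predUI leq_addr.
Qed.

Definition balls (l : seq (R * R)) : set R :=
  [set x | exists2 J, J \in l & `|x - J.1| <= J.2].

Definition total_length (l : seq (R * R)) : R := \sum_(J <- l) 2 * J.2.

Lemma closed_ballE (p r : R) : [set x | `|x - p| <= r] = `[p - r, p + r]%classic.
Proof. by apply/seteqP; split => x /=; rewrite in_itv /= ler_distl. Qed.

Lemma lebesgue_closed_ball (p r : R) : 0 <= r ->
  mu [set x | `|x - p| <= r] = (2 * r)%:E.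
Proof.
move=> r0; rewrite closed_ballE lebesgue_measure_itv /= lte_fin.
case: ltP => h; first by rewrite -EFinB; congr EFin; ring.
by congr EFin; lra.
Qed.

Lemma measurable_closed_ball (p r : R) : measurable [set x : R | `|x - p| <= r].
Proof. by rewrite closed_ballE; exact: measurable_itv. Qed.

Lemma balls_cons J l : balls (J :: l) = [set x | `|x - J.1| <= J.2] `|` balls l.
Proof.
apply/seteqP; split => [x [K]|x [xJ|[K Kl xK]]] /=.
- by rewrite inE => /orP[/eqP -> |Kl xK]; [left | right; exists K].
- by exists J; rewrite ?mem_head.
- by exists K; rewrite // inE Kl orbT.
Qed.

Lemma measurable_balls l : measurable (balls l).
Proof.
elim: l => [|J l IH].
  rewrite (_ : balls [::] = set0) //; by apply/seteqP; split => // x [].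
by rewrite balls_cons; apply: measurableU => //; exact: measurable_closed_ball.
Qed.

(** Disjointness is kept only as the inequality [total_length l <= mu (balls l)]. It survives adding
    balls that avoid each other and the old ones. *)
Lemma total_length_extend l (Q : seq R) (r : R) : 0 <= r ->
  ((total_length l)%:E <= mu (balls l))%E ->
  pairwise (fun p q => 2 * r < `|p - q|) Q ->
  {in Q & l, forall p J, r + J.2 < `|p - J.1|} ->
  ((total_length ([seq (p, r) | p <- Q] ++ l))%:E <=
     mu (balls ([seq (p, r) | p <- Q] ++ l)))%E.
Proof.
move=> r0 Vl; elim: Q => [//|p Q IH] /= /andP[pQ sepQ] far.
have farQ : {in Q & l, forall q J, r + J.2 < `|q - J.1|}.
  by move=> q J qQ Jl; apply: far => //; rewrite inE qQ orbT.
have := IH sepQ farQ.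
rewrite balls_cons /total_length big_cons /= => IH'.
rewrite measureU; first last.
- apply/seteqP; split => // x [/= xp [J]].
  rewrite mem_cat => /orP[/mapP[q qQ ->] /= xq|Jl xJ].
    have := allP pQ _ qQ; apply/negP; rewrite -leNgt.
    have := ler_distD x p q; rewrite [`|p - x|]distrC; lra.
  have := far p J (mem_head _ _) Jl; apply/negP; rewrite -leNgt.
  have := ler_distD x p J.1; rewrite [`|p - x|]distrC; lra.
- exact: measurable_balls.
- exact: measurable_closed_ball.
rewrite EFinD; apply: leeD => //.
by rewrite -(lebesgue_closed_ball p).
Qed.


Section Construction.
Variables (c D : R) (h : nat -> R) (B : pred nat) (P : nat -> seq R) (n0 : nat).
Variable E : set R.
Hypotheses (c0 : 0 < c) (D0 : 0 < D).
Hypothesis hc : forall n, 0 <= h n <= c / 4.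
Hypothesis Psize : forall n, (n0 <= n)%N -> B n -> D * 4 ^+ n <= (size (P n))%:R.
Hypothesis Psep : forall n, (n0 <= n)%N -> B n ->
  pairwise (fun p q => c / 4 ^+ n <= `|p - q|) (P n).
Hypothesis PE : forall n p, (n0 <= n)%N -> B n -> p \in P n ->
  [set x | `|x - p| <= h n / 4 ^+ n] `<=` E.
Hypothesis n0_large : 8 <= D * 4 ^+ n0.

Let four n : 0 < 4 ^+ n :> R. Proof. by rewrite exprn_gt0. Qed.

(* Selecting only this fraction of the available points keeps the number of
   earlier balls small enough to absorb the boundary terms in [hits_count]. *)
Let quota n := Num.truncn (D * 4 ^+ n / 8).

Let quota_le n : (quota n)%:R <= D * 4 ^+ n / 8.
Proof. by rewrite /quota truncn_le divr_ge0 // mulr_ge0 // ltW. Qed.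

Let quota_ge n : (n0 <= n)%N -> D * 4 ^+ n / 16 <= (quota n)%:R.
Proof.
move=> n0n.
have h1 : 1 <= D * 4 ^+ n / 8.
  rewrite ler_pdivlMr // mul1r; apply: le_trans n0_large _.
  by rewrite ler_pM2l // ler_weXn2l // ler1n.
have /andP[_] := truncn_itv (le_trans ler01 h1).
rewrite -/(quota n) -natr1 => h2.
have : (1 <= quota n)%N by rewrite /quota truncn_gt0.
rewrite -(ler_nat R); lra.
Qed.

Let hit n (p : R) (J : R * R) := `|p - J.1| <= h n / 4 ^+ n + J.2.

(** The hit points are [c / 4 ^ n]-separated in an interval of length [2 (h n / 4 ^ n + J.2)]. Since
    [h n <= c / 4], the term [2 h n / c] is at most [1 / 2]; with the 1 of [separated_size] it makes
    the [3 / 2]. *)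
Lemma hit_count n (J : R * R) : (n0 <= n)%N -> B n -> 0 <= J.2 ->
  (count (hit n ^~ J) (P n))%:R <= 2 * J.2 * (4 ^+ n / c) + 3 / 2.
Proof.
move=> n0n Bn J0; rewrite -size_filter.
have /andP[h0 h4] := hc n.
have q0 : 0 <= h n / 4 ^+ n by rewrite divr_ge0 // ltW.
apply: le_trans (@separated_size _ (J.1 - (h n / 4 ^+ n + J.2)) (J.1 + (h n / 4 ^+ n + J.2)) (c / 4 ^+ n) _ _ _ _) _.
- by rewrite divr_gt0.
- exact: (subseq_pairwise (filter_subseq _ _) (Psep n n0n Bn)).
- by move=> p; rewrite mem_filter /hit ler_distl => /andP[].
- lra.
have -> : J.1 + (h n / 4 ^+ n + J.2) - (J.1 - (h n / 4 ^+ n + J.2)) = 2 * (h n / 4 ^+ n + J.2) by ring.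
have -> : 2 * (h n / 4 ^+ n + J.2) / (c / 4 ^+ n) = 2 * J.2 * (4 ^+ n / c) + 2 * (h n / c).
  have f0 : 4 ^+ n != 0 :> R by rewrite gt_eqF.
  by field; rewrite f0 gt_eqF.
suff : h n / c <= 1 / 4 by lra.
by rewrite ler_pdivrMr //; lra.
Qed.

Lemma hits_count n (l : seq (R * R)) : (n0 <= n)%N -> B n -> {in l, forall J, 0 <= J.2} ->
  (count (fun p => has (hit n p) l) (P n))%:R <=
    total_length l * (4 ^+ n / c) + (size l)%:R * (3 / 2).
Proof.
move=> n0n Bn l0.
apply: le_trans (_ : (\sum_(J <- l) count (hit n ^~ J) (P n))%:R <= _).
  by rewrite ler_nat; exact: count_has_le.
rewrite /total_length; elim: l l0 => [|J l IH] l0.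
  by rewrite !big_nil /= !mul0r addr0.
rewrite !big_cons natrD /= -[(size l).+1%:R]natr1.
have h1 := hit_count n J n0n Bn (l0 J (mem_head _ _)).
have h2 : (\sum_(J <- l) count (hit n ^~ J) (P n))%:R <=
   (\sum_(J <- l) 2 * J.2) * (4 ^+ n / c) + (size l)%:R * (3 / 2).
  by apply: IH => K Kl; apply: l0; rewrite inE Kl orbT.
by lra.
Qed.

(** Smallness of [E] bounds [total_length l] by [c D / 8], which keeps the selection going. The
    bound on [size l] survives because old balls and quota together number at most [D 4 ^ X / 4].
    Each level of [B] adds length [quota n] times [2 h n / 4 ^ n], at least [D / 8] times [h n]. *)
Lemma greedy_step X : (n0 <= X)%N -> (mu E < (c * D / 8)%:E)%E -> measurable E ->
  exists l : seq (R * R), [/\ {in l, forall J, 0 <= J.2}, balls l `<=` E,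
    ((total_length l)%:E <= mu (balls l))%E, (size l)%:R <= D * 4 ^+ X / 8 &
    D / 8 * \sum_(n0 <= n < X | B n) h n <= total_length l].
Proof.
move=> n0X smallE mE; move: n0X => /subnK <-; elim: (X - n0)%N => [|d].
  rewrite add0n.
  exists [::]; split => //.
  - by move=> x [].
  - by rewrite /total_length big_nil measure_ge0.
  - by rewrite divr_ge0 // mulr_ge0 // ltW.
  - by rewrite big_geq // mulr0 /total_length big_nil.
rewrite addSn; move: (d + n0)%N (leq_addl d n0) => {}X n0X [l [l0 lE lV ls lh]].
case: (boolP (B X)) => BX; last first.
  exists l; split => //; last by rewrite big_mkcond big_nat_recr //= (negbTE BX) addr0 -big_mkcond.
  by apply: le_trans ls _; rewrite ler_pM2r // ler_pM2l // exprS; have := four X; lra.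
pose r := h X / 4 ^+ X.
have /andP[h0 h4] := hc X.
have r0 : 0 <= r by rewrite divr_ge0 // ltW.
pose good := [seq p <- P X | ~~ has (hit X p) l].
have Vsmall : total_length l <= c * D / 8.
  rewrite -lee_fin; apply: le_trans lV _; apply: le_trans (ltW smallE).
  by apply: le_measure => //; rewrite inE //; exact: measurable_balls.
(* Earlier balls block at most [(1 / 8 + 3 / 16) D 4 ^ X] points, one share from their length and
   one from their number. More than [D 4 ^ X / 8] remain. *)
have qgood : (quota X <= size good)%N.
  rewrite -(ler_nat R) /good size_filter.
  have := count_predC (fun p => has (hit X p) l) (P X) => /(congr1 (fun n => n%:R : R)).
  rewrite natrD (_ : count (predC _) _ = count (fun p => ~~ has (hit X p) l) (P X)) // => hcnt.
  have h1 := hits_count X l n0X BX l0.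
  have h2 := Psize X n0X BX.
  have h3 := quota_le X.
  have h5 : total_length l * (4 ^+ X / c) <= D * 4 ^+ X / 8.
    apply: le_trans (ler_wpM2r _ Vsmall) _; first by rewrite divr_ge0 // ltW.
    by rewrite le_eqVlt; apply/orP; left; apply/eqP; field; rewrite gt_eqF.
  have := four X; have : 0 < D * 4 ^+ X by rewrite mulr_gt0.
  by lra.
pose Q := take (quota X) good.
have sQ : size Q = quota X by rewrite size_takel.
have QP : {subset Q <= P X}.
  by move=> p /mem_take; rewrite mem_filter => /andP[].
have Qgood p : p \in Q -> ~~ has (hit X p) l.
  by move=> /mem_take; rewrite mem_filter => /andP[].
exists ([seq (p, r) | p <- Q] ++ l); split.
- by move=> J; rewrite mem_cat => /orP[/mapP[p _ ->]//|]; exact: l0.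
- move=> x [J]; rewrite mem_cat => /orP[/mapP[p pQ ->] /= xp|Jl xJ].
    by apply: (PE X p n0X BX (QP _ pQ)).
  by apply: lE; exists J.
- apply: total_length_extend => //.
  + have : pairwise (fun p q => c / 4 ^+ X <= `|p - q|) Q.
      apply: subseq_pairwise (Psep X n0X BX).
      exact: subseq_trans (take_subseq _ _) (filter_subseq _ _).
    apply: sub_pairwise => p q /=; apply: lt_le_trans.
    by rewrite /r mulrA ltr_pM2r ?invr_gt0 ?four //; have := c0; lra.
  + move=> p J pQ Jl; rewrite ltNge; apply/negP => hpJ.
    by have /negP := Qgood p pQ; apply; apply/hasP; exists J.
- rewrite size_cat size_map sQ natrD.
  have DX : 0 < D * 4 ^+ X by rewrite mulr_gt0.
  by have := quota_le X; rewrite exprS; lra.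
- rewrite big_mkcond big_nat_recr //= BX -big_mkcond /total_length big_cat /= -/(total_length l) big_map /=.
  rewrite big_const_seq count_predT sQ iter_addr_0 -[_ *+ quota X]mulr_natl.
  have : D / 8 * h X <= (quota X)%:R * (2 * r).
    apply: le_trans (ler_wpM2r _ (quota_ge X n0X)); last by rewrite mulr_ge0.
    rewrite le_eqVlt; apply/orP; left; apply/eqP; rewrite /r; field.
    by rewrite gt_eqF.
  by lra.
Qed.

Lemma greedy_measure_ge : measurable E ->
  (forall A, exists2 X, (n0 <= X)%N & A <= \sum_(n0 <= n < X | B n) h n) ->
  ((c * D / 8)%:E <= mu E)%E.
Proof.
move=> mE unb; rewrite leNgt; apply/negP => smallE.
have [X n0X hX] := unb (c + 1).
have [l [l0 lE lV _ lh]] := greedy_step X n0X smallE mE.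
have : ((total_length l)%:E < (c * D / 8)%:E)%E.
  apply: le_lt_trans smallE; apply: le_trans lV _.
  by apply: le_measure => //; rewrite inE //; exact: measurable_balls.
rewrite lte_fin; apply/negP; rewrite -leNgt; apply: le_trans lh.
rewrite (_ : c * D / 8 = D / 8 * c); last by ring.
by rewrite ler_pM2l ?divr_gt0 //; lra.
Qed.

End Construction.
End Greedy.

(** * Divergent sums over a set of levels *)

Definition unbounded_sum {R : realType} (B : pred nat) (h : nat -> R) :=
  forall A, exists X, A <= \sum_(0 <= n < X | B n) h n.

Section UnboundedSum.
Variable R : realType.
Implicit Types (B : pred nat) (h : nat -> R).

Lemma sum_nat_mono B h m n : (forall k, 0 <= h k) -> (m <= n)%N ->
  \sum_(0 <= k < m | B k) h k <= \sum_(0 <= k < n | B k) h k.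
Proof.
by move=> h0 mn; rewrite (big_cat_nat _ mn) //= lerDl sumr_ge0.
Qed.

Lemma unbounded_sum_from B h n0 : (forall k, 0 <= h k) -> unbounded_sum B h ->
  forall A, exists2 X, (n0 <= X)%N & A <= \sum_(n0 <= n < X | B n) h n.
Proof.
move=> h0 unb A.
have [X hX] := unb (A + \sum_(0 <= n < n0 | B n) h n).
exists (maxn n0 X); first exact: leq_maxl.
have := le_trans hX (sum_nat_mono B h X _ h0 (leq_maxr n0 X)).
by rewrite (big_cat_nat (leq0n n0) (leq_maxl n0 X)) /= => hA; lra.
Qed.

(** The greedy selection needs [h <= c / 4]. If the truncated series converged, its terms would tend
    to 0, truncation would stop acting from some index on, and the original series would converge
    too. *)
Lemma unbounded_sum_min B h (e : R) : 0 < e -> (forall k, 0 <= h k) ->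
  unbounded_sum B h -> unbounded_sum B (fun n => Num.min (h n) e).
Proof.
move=> e0 h0 unb.
set g := fun n => Num.min (h n) e.
have g0 k : 0 <= g k by rewrite /g le_min h0 ltW.
pose f n := if B n then g n else 0.
have fE X : series f X = \sum_(0 <= n < X | B n) g n by rewrite /series /= [RHS]big_mkcond.
apply: contrapT => nunb.
have [A hA] : exists A, forall X, \sum_(0 <= n < X | B n) g n < A.
  have /existsNP[A hA] := nunb; exists A => X.
  by rewrite ltNge; apply/negP => ?; apply: hA; exists X.
have cv : cvgn (series f).
  apply: nondecreasing_is_cvgn.
    by move=> m n mn; rewrite !fE; exact: sum_nat_mono.
  by exists A => _ [X _ <-]; rewrite fE ltW.
have := cvg_series_cvg_0 cv => /cvgrPdist_lt /(_ _ e0)[n1 _ hn1].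
have eqh n : (n1 <= n)%N -> B n -> h n = g n.
  move=> /hn1 /=; rewrite sub0r normrN /f => + Bn; rewrite Bn ger0_norm // /g.
  by case: (leP (h n) e) => //; rewrite ltxx.
have [X n1X hX] := @unbounded_sum_from B h n1 h0 unb A.
have : \sum_(n1 <= n < X | B n) h n < A.
  rewrite big_nat_cond (eq_bigr g) => [|n /andP[/andP[n1n _] Bn]]; last exact: eqh.
  rewrite -big_nat_cond; apply: le_lt_trans (hA X).
  by rewrite [leRHS](big_cat_nat (leq0n n1) n1X) //= lerDr sumr_ge0.
by rewrite ltNge hX.
Qed.

Lemma nneseries_unbounded B h : (forall k, 0 <= h k) ->
  (\sum_(1 <= n <oo | B n) (h n)%:E)%E = +oo%E -> unbounded_sum B h.
Proof.
move=> h0 hoo A; apply: contrapT => /forallNP nX.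
have : (\sum_(1 <= n <oo | B n) (h n)%:E <= A%:E)%E.
  apply: lime_le; first by apply: is_cvg_nneseries => n _ _; rewrite lee_fin.
  near=> X; rewrite sumEFin lee_fin.
  have [X0|X1] := leqP X 1.
    rewrite big_geq //; apply: ltW; rewrite ltNge; apply/negP => A0.
    by apply: (nX 0%N); rewrite big_geq.
  apply: (@le_trans _ _ (\sum_(0 <= n < X | B n) h n)).
    by rewrite [leRHS](big_cat_nat (leq0n 1) (ltnW X1)) //= lerDr sumr_ge0.
  by apply: ltW; rewrite ltNge; apply/negP/nX.
by rewrite hoo leye_eq.
Unshelve. all: by end_near. Qed.

End UnboundedSum.

(** * Full measure from separated levels *)

Section FullMeasure.
Variable R : realType.
Local Notation mu := (@lebesgue_measure R).
Implicit Types (t z x c : R) (h : nat -> R) (B : pred nat).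

(** The part of the separation of level [n] that depends on [t]: after scaling by [2 ^ n], two
    points with different second indices differ, up to sign, by [k t - j] with [0 < k < 2 ^ n].
    Equal second indices leave a nonzero integer. *)
Definition spread c t (n : nat) := forall (k : nat) (j : int),
  (0 < k < 2 ^ n)%N -> c / 2 ^+ n <= `|k%:R * t - j%:~R|.

Lemma expr4E n : 4 ^+ n = 2 ^+ n * 2 ^+ n :> R.
Proof. by rewrite -exprMn -natrM. Qed.

Lemma spread_separated c t z n (j k j' k' : nat) : c <= 1 -> spread c t n ->
  (k < 2 ^ n)%N -> (k' < 2 ^ n)%N -> (j, k) != (j', k') ->
  c / 4 ^+ n <= `|pt t z n j k - pt t z n j' k'|.
Proof.
move=> c1 sp; wlog kk' : j k j' k' / (k' <= k)%N.
  move=> H hk hk' ne; case: (leqP k' k) => kk'; first exact: H.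
  by rewrite distrC; apply: H => //; [exact: ltnW | rewrite eq_sym].
move=> hk hk' ne.
have N0 : 0 < 2 ^+ n :> R by rewrite exprn_gt0.
rewrite /pt -mulrBl normrM normfV (gtr0_norm N0) expr4E invfM mulrA ler_pM2r ?invr_gt0 //.
have -> : z + j%:R + k%:R * t - (z + j'%:R + k'%:R * t) =
   (k - k')%N%:R * t - (j'%:Z - j%:Z)%:~R.
  by rewrite rmorphB /= -!pmulrn natrB //; ring.
move: kk'; rewrite leq_eqVlt => /orP[/eqP kE|kk']; last first.
  by apply: sp; rewrite subn_gt0 kk' /=; apply: leq_ltn_trans hk; rewrite leq_subr.
rewrite kE subnn mul0r sub0r normrN -intr_norm.
apply: (@le_trans _ _ 1).
  rewrite ler_pdivrMr // mul1r; apply: le_trans c1 _.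
  by rewrite -natrX ler1n expn_gt0.
rewrite (ler_int R 1) -gtz0_ge1 normr_gt0 subr_eq0.
by apply: contra_neq ne => -[->]; rewrite kE.
Qed.

(** If [k] is close to [kappa 2 ^ n], the first index leading to [x] is close to
    [(x - kappa t) 2 ^ n], which must lie between 0 and [2 ^ n]. The admissible [kappa] fill []L,
    H[]; its middle third leaves the margin [r0] on both sides. *)
Lemma central_strip t x : 0 < t -> t <= 1 -> 0 < x -> x < 1 + t ->
  exists k1 k2 r0 : R, [/\ 0 <= k1, k1 < k2, k2 <= 1, 0 < r0 &
     (k2 * t + r0 <= x) /\ (x + r0 <= 1 + k1 * t)].
Proof.
move=> t0 t1 x0 x1.
pose L := Num.max 0 ((x - 1) / t); pose H := Num.min 1 (x / t).
have LH : L < H.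
  rewrite /L /H gt_max !lt_min ltr01 divr_gt0 //= ltr_pM2r ?invr_gt0 //.
  by rewrite ltr_pdivrMr // mul1r; apply/andP; split; lra.
have L0 : 0 <= L by rewrite /L le_max lexx.
have Lx : x - 1 <= L * t by rewrite -ler_pdivrMr // /L le_max lexx orbT.
have H1 : H <= 1 by rewrite /H ge_min lexx.
have Hx : H * t <= x by rewrite -ler_pdivlMr // /H ge_min lexx orbT.
have dt : 0 < (H - L) * t by rewrite mulr_gt0 // subr_gt0.
exists (L + (H - L) / 3), (L + (H - L) * 2 / 3), ((H - L) * t / 3).
split; [lra|lra|lra|by rewrite divr_gt0|split].
- by rewrite mulrDl; lra.
- by rewrite mulrDl; lra.
Qed.

(* No equidistribution of [k t] is needed: for each [k] in a range of length
   proportional to [2^n], the condition on [j] is an interval of length [r 2^n / 2]. *)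
Lemma many_points c t z x : 0 < t -> t <= 1 -> 0 <= z -> z <= 1 + t -> 0 < c -> c <= 1 ->
  0 < x -> x < 1 + t -> exists2 d : R, 0 < d & exists2 r0 : R, 0 < r0 &
  forall r, 0 < r -> r <= r0 -> exists n0, forall n, (n0 <= n)%N -> spread c t n ->
    exists s : seq R, [/\ d * r * 4 ^+ n <= (size s)%:R,
      pairwise (fun p q => c / 4 ^+ n <= `|p - q|) s,
      {in s, forall p, `|p - x| <= r / 2} &
      {in s, forall p, exists j k, [/\ (j < 2 ^ n)%N, (k < 2 ^ n)%N & p = pt t z n j k]}].
Proof.
move=> t0 t1 z0 z1 c0 c1 x0 x1.
have [k1 [k2 [r0 [k10 k12 k21 r00 [hk2 hk1]]]]] := central_strip t x t0 t1 x0 x1.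
(* Each index keeps a quarter of its range, one half by choice and one half by rounding: [1 / 4] for
   [k] times [1 / 4] for [j]. *)
exists ((k2 - k1) / 16); first by rewrite divr_gt0 // subr_gt0.
exists r0 => // r r_gt0 rr0.
(* For large [n] all three quantities times [2 ^ n] are at least 2, which absorbs [z <= 2] and the
   roundings. *)
pose m := Num.min (Num.min r0 (k2 - k1)) r.
have m0 : 0 < m by rewrite !lt_min r00 subr_gt0 k12 r_gt0.
exists (Num.truncn (2 / m)).+1 => n n0n sp.
pose N := 2 ^+ n : R.
have N0 : 0 < N by rewrite exprn_gt0.
have mN : 2 <= m * N.
  rewrite mulrC -ler_pdivrMr // ltW //.
  apply: lt_le_trans (_ : (Num.truncn (2 / m)).+1%:R <= _).
    by have /andP[] := @truncn_itv _ (2 / m) ltac:(by rewrite divr_ge0 // ltW).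
  by rewrite /N -natrX ler_nat; apply: leq_trans n0n _; exact/ltnW/ltn_expl.
have mr0 : 2 <= r0 * N by apply: le_trans mN _; rewrite ler_pM2r // !ge_min lexx.
have mk : 2 <= (k2 - k1) * N by apply: le_trans mN _; rewrite ler_pM2r // !ge_min lexx orbT.
have mr : 2 <= r * N by apply: le_trans mN _; rewrite ler_pM2r // !ge_min lexx !orbT.
pose K := (Num.truncn (k1 * N)).+1.
pose A := Num.truncn ((k2 - k1) * N / 2).
pose W := Num.truncn (r * N / 2).
(* [pt t z n j k] would equal [x] for [j = y k]. From the next integer [J k] on, [W] consecutive
   values of [j] stay within [r / 2] to the right of [x]. *)
pose y (k : nat) := N * x - z - k%:R * t.
pose J k := (Num.truncn (y k)).+1.
have KA a : (a < A)%N -> k1 * N < (K + a)%:R < k2 * N.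
  move=> aA; rewrite /K natrD.
  have k1N : 0 <= k1 * N by rewrite mulr_ge0 // ltW.
  have /andP[h1 h2] := truncn_itv k1N.
  have hA : A%:R <= (k2 - k1) * N / 2 by rewrite truncn_le; lra.
  move: aA; rewrite -(ler_nat R) => aA.
  rewrite -!natr1 in aA h2 *.
  have a0 : 0 <= a%:R :> R by [].
  by apply/andP; split; lra.
have y0 a : (a < A)%N -> 0 <= y (K + a)%N.
  move=> /KA /andP[_ /ltW h]; rewrite /y.
  have : (K + a)%:R * t <= k2 * N * t by rewrite ler_pM2r.
  have : N * (k2 * t + r0) <= N * x by rewrite ler_pM2l.
  by lra.
have JW a b : (a < A)%N -> (b < W)%N ->
    y (K + a)%N < (J (K + a) + b)%:R <= y (K + a)%N + r * N / 2.
  move=> aA bW; rewrite /J natrD.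
  have /andP[h1 h2] := truncn_itv (y0 a aA).
  have hW : W%:R <= r * N / 2 by rewrite truncn_le; lra.
  move: bW; rewrite -(ler_nat R) => bW.
  rewrite -[b.+1%:R]natr1 in bW.
  rewrite -[(Num.truncn _).+1%:R]natr1 in h2 *.
  have b0 : 0 <= b%:R :> R by [].
  by apply/andP; split; lra.
pose idx := [seq ((J (K + a) + b)%N, (K + a)%N) | a <- iota 0 A, b <- iota 0 W].
have idxP i : i \in idx -> exists a b, [/\ (a < A)%N, (b < W)%N & i = ((J (K + a) + b)%N, (K + a)%N)].
  move=> /allpairsP[[a b] /= [ha hb ->]]; exists a, b.
  by move: ha hb; rewrite !mem_iota !add0n.
have idx_lt i : i \in idx -> (i.1 < 2 ^ n)%N /\ (i.2 < 2 ^ n)%N.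
  move=> /idxP[a [b [aA bW ->]]] /=.
  have /andP[h1 h2] := KA a aA; have /andP[h3 h4] := JW a b aA bW.
  rewrite -!(ltr_nat R) natrX -/N; split.
    have : (K + a)%:R * t > k1 * N * t by rewrite ltr_pM2r.
    have : N * (x + r0) <= N * (1 + k1 * t) by rewrite ler_pM2l.
    have : N * r <= N * r0 by rewrite ler_pM2l.
    have : 0 < N * r0 by rewrite mulr_gt0.
    by rewrite /y in h4; lra.
  by apply: lt_le_trans h2 _; rewrite ger_pMl.
have u : uniq idx.
  apply: allpairs_uniq; rewrite ?iota_uniq // => -[a b] [a' b'] _ _ /= [].
  by move=> h1 /eqP; rewrite eqn_add2l => /eqP h2; move: h1; rewrite h2 => /eqP; rewrite eqn_add2l => /eqP ->.
exists [seq pt t z n i.1 i.2 | i <- idx]; split.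
- rewrite size_map size_allpairs !size_iota natrM.
  have hA : (k2 - k1) * N / 4 <= A%:R.
    have hh : 1 <= (k2 - k1) * N / 2 by lra.
    have /andP[_] := truncn_itv (le_trans ler01 hh); rewrite -/A -[A.+1%:R]natr1 => h2.
    have : (1 <= A)%N by rewrite /A truncn_gt0.
    rewrite -(ler_nat R); lra.
  have hW : r * N / 4 <= W%:R.
    have hh : 1 <= r * N / 2 by lra.
    have /andP[_] := truncn_itv (le_trans ler01 hh); rewrite -/W -[W.+1%:R]natr1 => h2.
    have : (1 <= W)%N by rewrite /W truncn_gt0.
    rewrite -(ler_nat R); lra.
  apply: le_trans (ler_pM _ _ hA hW); [|lra|lra].
  by rewrite expr4E -/N le_eqVlt; apply/orP; left; apply/eqP; field.
- rewrite pairwise_map; move: u; rewrite uniq_pairwise.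
  apply: sub_in_pairwise (allss _) => i i' /idx_lt[hi1 hi2] /idx_lt[hi1' hi2'] /= ne.
  by apply: spread_separated => //; rewrite -!surjective_pairing.
- move=> p /mapP[i /idxP[a [b [aA bW ->]]] ->] /=.
  have /andP[h3 h4] := JW a b aA bW.
  rewrite /pt (_ : _ - x = ((J (K + a) + b)%:R - y (K + a)%N) / N); last first.
    by rewrite /y -/N; field; rewrite gt_eqF.
  rewrite normrM normfV (gtr0_norm N0) ler_pdivrMr // ger0_norm ?subr_ge0 ?(ltW h3) //.
  lra.
- move=> p /mapP[i ii ->]; have [h1 h2] := idx_lt i ii.
  by exists i.1, i.2.
Qed.

End FullMeasure.

(** * Density of the tail unions *)

Section AlmostEvery.
Variable R : realType.
Local Notation mu := (@lebesgue_measure R).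
Implicit Types (t z x c : R) (h : nat -> R) (B : pred nat).

Definition level t z n (r : R) : set R :=
  balls R [seq (pt t z n j k, r) | j <- iota 0 (2 ^ n), k <- iota 0 (2 ^ n)].

Lemma levelP t z n r x : level t z n r x <-> exists j k : nat,
  [/\ (j < 2 ^ n)%N, (k < 2 ^ n)%N & `|x - pt t z n j k| <= r].
Proof.
split=> [[J /allpairsP[[j k] /= [hj hk ->]] /= hx]|[j [k [hj hk hx]]]].
  by exists j, k; move: hj hk; rewrite !mem_iota !add0n.
exists (pt t z n j k, r) => //; apply/allpairsP; exists (j, k).
by rewrite !mem_iota !add0n.
Qed.

Lemma measurable_level t z n r : measurable (level t z n r).
Proof. exact: measurable_balls. Qed.

Definition tail_hits t z h N : set R := \bigcup_(n in [set n | (N <= n)%N]) level t z n (h n / 4 ^+ n).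

Lemma measurable_tail_hits t z h N : measurable (tail_hits t z h N).
Proof. by apply: bigcup_measurable => n _; exact: measurable_level. Qed.

Lemma U_tail_hits t z h x : U t z h x <-> forall N, tail_hits t z h N x.
Proof.
rewrite U_ptP; split => H N.
  by have [n Nn [j [k hjk]]] := H N; exists n => //; apply/levelP; exists j, k.
by have [n Nn /levelP hjk] := H N; exists n.
Qed.

(** Greedy selection with [D = d r], where [E] is the part of [ball x r] covered by the tail. As [D]
    is proportional to [r], the bound is a fixed fraction of the ball; the selection may start at
    any level beyond [N]. *)
Lemma tail_hits_ball c t z B h x N : 0 < t -> t <= 1 -> 0 <= z -> z <= 1 + t ->
  0 < c -> c <= 1 -> (forall n, B n -> spread R c t n) ->
  (forall n, 0 <= h n <= c / 4) -> unbounded_sum B h -> 0 < x -> x < 1 + t ->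
  exists2 e : R, 0 < e & exists2 r0 : R, 0 < r0 & forall r, 0 < r -> r <= r0 ->
    ((e * r)%:E <= mu (ball x r `&` tail_hits t z h N))%E.
Proof.
move=> t0 t1 z0 z1 c0 c1 sp hc unb x0 x1.
have [d d0 [r0 r00 H]] := many_points R c t z x t0 t1 z0 z1 c0 c1 x0 x1.
exists (c * d / 8); first by rewrite divr_gt0 // mulr_gt0.
exists r0 => // r r_gt0 rr0.
have [n1 Hn1] := H r r_gt0 rr0.
(* [8 / (d r)] provides [n0_large]; [1 / r] makes the radii smaller than [r / 2], so that the balls
   stay inside [ball x r]. *)
pose n2 := (Num.truncn (8 / (d * r) + 1 / r)).+1.
pose n0 := maxn (maxn n1 N) n2.
have dr0 : 0 < d * r by rewrite mulr_gt0.
have large : 8 / (d * r) + 1 / r < 4 ^+ n0.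
  have h1 : 0 <= 8 / (d * r) + 1 / r by rewrite addr_ge0 // divr_ge0 // ltW.
  have /andP[_ h2] := truncn_itv h1.
  apply: lt_le_trans h2 _; rewrite -natrX ler_nat.
  by apply: leq_trans (leq_maxr _ _) _; exact/ltnW/ltn_expl.
have /choice[P HP] : forall n, exists s : seq R, (n0 <= n)%N -> B n ->
   [/\ d * r * 4 ^+ n <= (size s)%:R,
      pairwise (fun p q => c / 4 ^+ n <= `|p - q|) s,
      {in s, forall p, `|p - x| <= r / 2} &
      {in s, forall p, exists j k, [/\ (j < 2 ^ n)%N, (k < 2 ^ n)%N & p = pt t z n j k]}].
  move=> n; case: (boolP ((n0 <= n)%N && B n)) => [/andP[n0n Bn]|nn]; last first.
    by exists [::] => n0n Bn; move: nn; rewrite n0n Bn.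
  have [|s hs] := Hn1 n _ (sp n Bn).
    by apply: leq_trans n0n; rewrite /n0 !leq_max leqnn.
  by exists s.
rewrite (_ : c * d / 8 * r = c * (d * r) / 8); last by ring.
apply: (@greedy_measure_ge R c (d * r) h B P n0) => //.
- by move=> n n0n Bn; have [] := HP n n0n Bn.
- by move=> n n0n Bn; have [] := HP n n0n Bn.
- move=> n p n0n Bn pP; have [_ _ h1 h2] := HP n n0n Bn.
  move=> y /= yp; split.
    have /andP[hn0 hn1] := hc n.
    have h3 : h n / 4 ^+ n < r / 2.
      rewrite ltr_pdivrMr ?exprn_gt0 //.
      have h4 : 4 ^+ n0 <= 4 ^+ n :> R by rewrite ler_weXn2l // ler1n.
      have h5 : 1 / r < 4 ^+ n.
        apply: lt_le_trans h4; apply: le_lt_trans large.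
        by rewrite lerDr divr_ge0 // ltW.
      by move: h5; rewrite ltr_pdivrMr // mulrC; lra.
    rewrite /ball /= distrC.
    have := h1 p pP; have := ler_distD p y x; lra.
  have [j [k [hj hk pE]]] := h2 p pP.
  exists n; last by apply/levelP; exists j, k; rewrite -pE.
  by apply: leq_trans n0n; rewrite /n0 !leq_max leqnn orbT.
- have h6 : 8 / (d * r) <= 4 ^+ n0.
    by apply: le_trans (ltW large); rewrite lerDl divr_ge0 // ltW.
  by move: h6; rewrite ler_pdivrMr // mulrC.
- by apply: measurableI; [exact: measurable_realfun.measurable_ball|exact: measurable_tail_hits].
- apply: unbounded_sum_from => // n; by have /andP[] := hc n.
Qed.

Lemma lebesgue_negligible_set1 (a : R) : mu.-negligible [set a].
Proof. by exists [set a]; split => //; exact: lebesgue_measure_set1. Qed.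

Lemma full_measure c t z B h : 0 < t -> t <= 1 -> z \in `[0, 1 + t] ->
  0 < c -> c <= 1 -> (forall n, B n -> spread R c t n) ->
  (forall n, 0 <= h n) -> unbounded_sum B h -> ae_in_U t z h.
Proof.
move=> t0 t1; rewrite in_itv /= => /andP[z0 z1] c0 c1 sp h0 unb.
pose g n := Num.min (h n) (c / 4).
have gc n : 0 <= g n <= c / 4.
  by rewrite /g le_min h0 divr_ge0 ?(ltW c0) //= ge_min lexx orbT.
have ugb : unbounded_sum B g by apply: unbounded_sum_min => //; rewrite divr_gt0.
(* The tail takes [e r] out of each small ball of length [2 r], so [F N] has density at most
   [1 - e / 2] at each of its points, while almost every point has density 1. *)
pose F N := `]0, 1 + t[%classic `\` tail_hits t z g N.
have mF N : measurable (F N) by apply: measurableD => //; exact: measurable_tail_hits.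
have F0 N : mu.-negligible (F N).
  apply: negligibleS (lebesgue_density (mF N)) => x Fx /= cv.
  have [/=] := Fx; rewrite in_itv /= => /andP[x0 x1] _.
  have [e e0 [r0 r00 H]] := tail_hits_ball c t z B g x N t0 t1 z0 z1 c0 c1 sp gc ugb x0 x1.
  have : ((\1_(F N) x)%:E <= (1 - e / 2)%:E :> \bar R)%E.
    rewrite -(cvg_lim _ cv) //; apply: lime_le; first by apply/cvg_ex; eexists; exact: cv.
    near=> r.
    have r_gt0 : 0 < r by [].
    have rr0 : r <= r0 by near: r; apply: nbhs_right_le.
    rewrite lebesgue_measure_ball ?(ltW r_gt0) // inver gt_eqF ?mulrn_wgt0 //.
    have mt : measurable (ball x r `&` tail_hits t z g N).
      by apply: measurableI; [exact: measurable_realfun.measurable_ball|exact: measurable_tail_hits].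
    have mb : measurable (F N `&` ball x r).
      by apply: measurableI => //; exact: measurable_realfun.measurable_ball.
    have hsum : (mu (F N `&` ball x r) + mu (ball x r `&` tail_hits t z g N) <= (r *+ 2)%:E)%E.
      rewrite -(lebesgue_measure_ball x (ltW r_gt0)) -measureU //; last first.
        by apply/seteqP; split => // y [[[_ ny] _] [_ yt]].
      apply: le_measure; rewrite ?inE //; first exact: measurableU.
        exact: measurable_realfun.measurable_ball.
      by move=> y [[]|[]].
    rewrite lee_pdivrMr ?mulrn_wgt0 //.
    have : (mu (F N `&` ball x r) + (e * r)%:E <= (r *+ 2)%:E)%E.
      by apply: le_trans hsum; rewrite leeD2l //; exact: H.
    rewrite -leeBrDr // -EFinB => /le_trans; apply.
    by rewrite -EFinM lee_fin -[r *+ 2]mulr_natr; lra.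
  rewrite indicE mem_set // lee_fin mulr1n => h1e; lra.
apply: negligibleS (negligibleU (negligible_bigcup F0)
  (negligibleU (lebesgue_negligible_set1 0) (lebesgue_negligible_set1 (1 + t)))).
move=> x /=; rewrite in_itv /= => -[/andP[x0 x1] nU].
have [->|xn0] := eqVneq x 0; first by right; left.
have [->|xn1] := eqVneq x (1 + t); first by right; right.
left; have /existsNP[N hN] : ~ forall N, tail_hits t z h N x by rewrite -U_tail_hits.
exists N => //; split.
  by rewrite /= in_itv /= !lt_neqAle x0 x1 eq_sym xn0 xn1.
move=> [n Nn /levelP[j [k [hj hk hx]]]]; apply: hN; exists n => //.
apply/levelP; exists j, k; split => //; apply: le_trans hx _.
by rewrite ler_pM2r ?invr_gt0 ?exprn_gt0 // /g ge_min lexx.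
Unshelve. all: by end_near.
Qed.

End AlmostEvery.

(** * Irrational parameters: parts 2, 3 and 5 *)

Section Density.
Variable R : realType.
Implicit Types (t z : R) (h : nat -> R) (B : pred nat).

Lemma lower_density_ge B (a : R) (n0 : nat) :
  (forall n, (n0 <= n)%N -> a <= (count B (iota 1 n))%:R / n%:R) -> a <= lower_density R B.
Proof.
move=> ha; rewrite /lower_density.
set u := fun n : nat => (count B (iota 1 n))%:R / n%:R.
have u0 n : 0 <= u n by rewrite divr_ge0.
have u1 n : u n <= 1.
  rewrite /u; case: n => [|n]; first by rewrite invr0 mulr0.
  rewrite ler_pdivrMr ?ltr0n // mul1r ler_nat.
  by apply: leq_trans (count_size _ _) _; rewrite size_iota.
have bu : bounded_fun u.
  exists 1; split => // x x1 n _; apply: le_trans (ltW x1).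
  by rewrite ger0_norm.
rewrite limn_infE //; apply: (@le_trans _ _ (infs u n0)).
  apply: lb_le_inf; first by exists (u n0); exists n0 => /=.
  by move=> _ [n /= n0n <-]; exact: ha.
by apply: ub_le_sup; [exact: bounded_fun_has_ubound_infs | exists n0].
Qed.

(** The [i]-th element of [B] receives [1 / i]: the values tend to 0, while the sum over an infinite
    [B] is the harmonic series. *)
Definition counting_harmonic B (n : nat) : R :=
  if B n then ((count B (iota 0 n)).+1%:R)^-1 else 0.

Lemma sum_counting_harmonic B X :
  \sum_(0 <= n < X | B n) counting_harmonic B n = series harmonic (count B (iota 0 X)) :> R.
Proof.
elim: X => [|X IH]; first by rewrite big_geq // /series /= big_geq.
have -> : iota 0 X.+1 = iota 0 X ++ [:: X] by rewrite -addn1 iotaD.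
rewrite big_mkcond big_nat_recr //= -big_mkcond IH.
rewrite count_cat /= addn0 /counting_harmonic.
case: ifP => BX; last by rewrite addn0 addr0.
by rewrite BX addn1 /series /= big_nat_recr.
Qed.

Lemma count_iota_unbounded B : (forall N, exists2 n, (N <= n)%N & B n) ->
  forall N, exists X, forall Y, (X <= Y)%N -> (N <= count B (iota 0 Y))%N.
Proof.
move=> infB; elim=> [|N [X hX]]; first by exists 0%N.
have [n Xn Bn] := infB X; exists n.+1 => Y nY.
have -> : iota 0 Y = iota 0 n ++ n :: iota n.+1 (Y - n.+1).
  by rewrite {1}(_ : Y = (n + (Y - n.+1).+1)%N) ?iotaD ?add0n //; lia.
by rewrite count_cat /= Bn; have := hX n Xn; lia.
Qed.

Lemma exists_vanishing_unbounded B : (forall N, exists2 n, (N <= n)%N & B n) ->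
  exists h : nat -> R, [/\ (forall n, 0 <= h n), h @ \oo --> (0 : R) & unbounded_sum B h].
Proof.
move=> infB; exists (counting_harmonic B); split.
- by move=> n; rewrite /counting_harmonic; case: ifP.
- apply/cvgrPdist_lt => e e0.
  have [X hX] := count_iota_unbounded B infB (Num.truncn e^-1).
  exists X => // n /= Xn; rewrite sub0r normrN /counting_harmonic; case: ifP => _; last by rewrite normr0.
  rewrite ger0_norm // -[ltRHS]invrK ltf_pV2 ?posrE ?invr_gt0 //.
  have /andP[_ h2] := @truncn_itv _ e^-1 ltac:(by rewrite invr_ge0 ltW).
  by apply: lt_le_trans h2 _; rewrite ler_nat ltnS; exact: hX.
- move=> A; apply: contrapT => /forallNP nX.
  apply: (@dvg_harmonic R); apply: nondecreasing_is_cvgn.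
    by apply: nondecreasing_series => n _ _ ; rewrite /harmonic /= invr_ge0.
  exists A => _ [N _ <-].
  have [X hX] := count_iota_unbounded B infB N.
  have := nX X; rewrite sum_counting_harmonic => /negP; rewrite -ltNge => /ltW.
  apply: le_trans.
  have nd : nondecreasing_seq (series (harmonic : R ^nat)).
    by apply: nondecreasing_series => n _ _; rewrite /harmonic /= invr_ge0.
  by apply: nd; exact: hX.
Qed.

End Density.

Section Irrational.
Variables (R : realType) (t : R).
Hypotheses (t01 : t \in `[0, 1]) (tirr : ~ is_rational t).

Lemma irrational_gt0 : 0 < t.
Proof. by have /andP[] := iter_gauss_itv R t t01 tirr 0. Qed.

Lemma irrational_le1 : t <= 1.
Proof. by have /andP[_ /ltW] := iter_gauss_itv R t t01 tirr 0. Qed.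

(** Every [k < 2 ^ n] satisfies [2 k <= q_m], so [cf_lower] applies, and [q_m <= K 2 ^ n] brings
    [1 / (2 q_m)] to the scale [2 ^- n]. A level is good as soon as some [q_m] lies a bounded factor
    above it. *)
Lemma cf_spread m n (K : nat) : (2 ^ n.+1 <= cf_q t m)%N -> (cf_q t m <= K * 2 ^ n)%N ->
  spread R ((2 * K%:R)^-1) t n.
Proof.
move=> h1 h2 k j /andP[k0 kn].
have kq : (2 * k <= cf_q t m)%N by apply: leq_trans h1; rewrite expnS leq_mul2l ltnW.
apply: le_trans (cf_lower R t t01 tirr m k j k0 kq).
have q0 := cf_q_gt0 R t t01 tirr m.
have K0 : (0 < K)%N by case: K h2 => //; rewrite mul0n leqNgt q0.
rewrite -invfM lef_pV2 ?posrE ?mulr_gt0 ?exprn_gt0 ?ltr0n //.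
by rewrite -mulrA ler_pM2l // -natrX -natrM ler_nat.
Qed.

Lemma cf_interval n : exists m, (cf_q t m <= 2 ^ n < cf_q t m.+1)%N.
Proof.
have ex : exists m, (2 ^ n < cf_q t m)%N.
  exists n.+1.*2; apply: leq_trans (cf_q_expn R t t01 tirr n.+1).
  by rewrite ltn_exp2l.
have [[|m] hm hmin] := ex_minnP ex.
  by move: hm; rewrite ltnS leqn0 expn_eq0.
exists m; rewrite hm andbT leqNgt; apply/negP => /hmin; lia.
Qed.

Lemma inv_nat_le1 (K : nat) : (2 * K.+1%:R)^-1 <= 1 :> R.
Proof. by rewrite invf_le1 ?mulr_gt0 // -natrM ler1n; lia. Qed.

Lemma inv_nat_gt0 (K : nat) : 0 < (2 * K.+1%:R)^-1 :> R.
Proof. by rewrite invr_gt0 mulr_gt0. Qed.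

Lemma irrational_vanishing_full : exists h : nat -> R, (forall n, 0 <= h n) /\
  h @ \oo --> (0 : R) /\ (forall z : R, z \in `[0, 1 + t] -> ae_in_U t z h).
Proof.
(* [K = 4]: with [n + 1] the integer part of [log2 q_m], one has [2 ^ (n + 1) <= q_m < 4 * 2 ^ n],
   so infinitely many levels share [c = 1 / 8]. *)
pose B n := `[< spread R ((2 * 4%:R)^-1) t n >].
have infB N : exists2 n, (N <= n)%N & B n.
  have h0 := cf_q_expn R t t01 tirr N.+1.
  set q := cf_q t _ in h0; have q0 : (0 < q)%N by rewrite /q cf_q_gt0.
  have /andP[h1 h2] := trunc_log_bounds (isT : 1 < 2)%N q0.
  have Nl : (N.+1 <= trunc_log 2 q)%N.
    by have := leq_ltn_trans h0 h2; rewrite ltn_exp2l.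
  move: (trunc_log 2 q) Nl h1 h2 => [//|n] Nn h1 h2.
  exists n => //; apply/asboolP; apply: cf_spread h1 _.
  by move: h2; rewrite !expnS; lia.
have [h [h0 hto0 unb]] := exists_vanishing_unbounded R B infB.
exists h; split => //; split => // z zt.
apply: (full_measure R _ t z B h irrational_gt0 irrational_le1 zt (inv_nat_gt0 3) (inv_nat_le1 3)) => //.
by move=> n /asboolP.
Qed.

Lemma badly_approximable_full z h : badly_approximable t -> z \in `[0, 1 + t] ->
  (forall n, 0 <= h n) -> (\sum_(1 <= n <oo) (h n)%:E)%E = +oo%E -> ae_in_U t z h.
Proof.
move=> [_ [C hC]] zt h0 hoo.
have unb := nneseries_unbounded R predT h h0 hoo.
(* [q_{m+1} <= (C + 1) q_m <= (2 C + 2) 2 ^ n]; the last 1 is added inside [inv_nat_gt0]. *)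
apply: (full_measure R _ t z predT h irrational_gt0 irrational_le1 zt
  (inv_nat_gt0 (C.*2.+1)) (inv_nat_le1 _)) => // n _.
have [m /andP[h1 h2]] := cf_interval n.+1.
apply: (cf_spread m.+1); first exact: ltnW.
apply: leq_trans (cf_q_le_digit R t t01 tirr m) _.
have := hC m.+1; rewrite expnS in h1; nia.
Qed.

(** With [E] the integer part of [log2 e], at most [E + 1] powers of two fit into [[a, e a[];
    [e > 1] gives [E >= 1], hence [E + 1 <= 2 log2 e]. *)
Lemma count_dyadic_le (a b e X : nat) : (b <= e * a)%N -> (0 < a)%N -> (1 < e)%N ->
  (count (fun n => (a <= 2 ^ n.+1 < b)%N) (iota 1 X))%:R <= 2 * log2 (e%:R : R).
Proof.
move=> be a0 e1.
have e0 : (0 < e)%N by lia.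
set E := trunc_log 2 e.
have /andP[h1 h2] := trunc_log_bounds (isT : 1 < 2)%N e0; rewrite -/E in h1 h2.
have h3 := up_logP a (isT : 1 < 2)%N; set V := up_log 2 a in h3.
have E1 : (1 <= E)%N.
  by have := leq_ltn_trans e1 h2; rewrite -{1}(expn1 2) ltn_exp2l.
have : (count (fun n => (a <= 2 ^ n.+1 < b)%N) (iota 1 X) <= E.+1)%N.
  rewrite -size_filter -[E.+1](size_iota V.-1); apply: uniq_leq_size.
    by rewrite filter_uniq // iota_uniq.
  move=> n; rewrite mem_filter mem_iota => /andP[/andP[g1 g2] _].
  have g3 : (V <= n.+1)%N by apply: up_log_min.
  have : (2 ^ n.+1 < 2 ^ (E.+1 + V))%N.
    rewrite expnD; apply: leq_trans g2 _; apply: leq_trans be _.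
    by apply: leq_mul => //; exact: ltnW.
  rewrite ltn_exp2l // mem_iota; lia.
rewrite -(ler_nat R) => /le_trans; apply.
have : E%:R <= log2 (e%:R : R).
  rewrite /log2 ler_pdivlMr ?ln_gt0 ?ltr1n //.
  rewrite mulr_natl -lnXn // ler_ln ?posrE ?exprn_gt0 ?ltr0n //.
  by rewrite -natrX ler_nat.
rewrite -natr1; move: E1; rewrite -(ler_nat R); lra.
Qed.

Definition digit_condition := forall eps : R, 0 < eps -> exists L : nat,
  \forall M \near \oo,
    \sum_(1 <= m < M.+1 | (L%:R : R) <= (cf_q t m.+1)%:R / (cf_q t m)%:R)
        log2 ((cf_digit t m.+1)%:R + 1) <= eps * M%:R.

Lemma log2_ge0 (x : R) : 1 <= x -> 0 <= log2 x.
Proof. by move=> x1; rewrite /log2 divr_ge0 ?ln_ge0 // ler1n. Qed.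

(** A level can fail only if [2 ^ (n + 1)] lies in a gap [[q_m, q_{m+1}[] of large ratio, and such a
    gap contains at most [2 log2 (zeta_{m+1} + 1)] levels. The digit condition makes these levels
    sparse, so [h] still diverges over the others. *)
Lemma digit_condition_good : digit_condition -> good_param t.
Proof.
move=> dc z zt h [e0 /andP[e0_gt0 e0_lt1] [h0 hB]].
(* The factor 2 per gap and the factor 2 in [M = 2 X + 3] turn [e0 / 20] into a bad density
   [e0 / 5]; the bounded terms, among them the gap [m = 0], fit below [e0 / 2]. *)
have [|L [M0 _ hM]] := dc (e0 / 20); first by rewrite divr_gt0.
pose large m := (L%:R : R) <= (cf_q t m.+1)%:R / (cf_q t m)%:R.
pose D m n := (cf_q t m <= 2 ^ n.+1 < cf_q t m.+1)%N.
pose B n := `[< exists2 m, D m n & ~~ large m >].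
pose Z m : R := log2 ((cf_digit t m.+1)%:R + 1).
have cnt X m : (count (D m) (iota 1 X))%:R <= 2 * Z m.
  rewrite /Z natr1; apply: count_dyadic_le.
  - exact: cf_q_le_digit.
  - exact: cf_q_gt0.
  - exact: cf_digit_gt0.
have bad X : (M0 <= X)%N ->
    (count (predC B) (iota 1 X))%:R <= 2 * Z 0%N + e0 / 10 * (2 * X%:R + 3).
  move=> M0X; set M := (2 * X + 3)%N.
  apply: (@le_trans _ _ (count (fun n => has (fun m => D m n) [seq m <- iota 0 M.+1 | large m]) (iota 1 X))%:R).
    rewrite ler_nat -!size_filter; apply: uniq_leq_size.
      by rewrite filter_uniq // iota_uniq.
    move=> n; rewrite !mem_filter => /andP[nB nX]; rewrite nX andbT.
    have [m hm] := cf_interval n.+1.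
    apply/hasP; exists m => //; rewrite mem_filter; apply/andP; split.
      by apply: contraNT nB => nl; apply/asboolP; exists m.
    move: nX; rewrite !mem_iota => /andP[_ nX].
    move: hm => /andP[/(leq_expn_cf_q R t t01 tirr) hm _].
    rewrite /M; lia.
  apply: (@le_trans _ _ (\sum_(m <- [seq m <- iota 0 M.+1 | large m]) count (D m) (iota 1 X))%:R).
    by rewrite ler_nat; exact: (count_has_le _ _ (fun n m => D m n)).
  rewrite natr_sum big_filter.
  apply: (@le_trans _ _ (\sum_(0 <= m < M.+1 | large m) 2 * Z m)).
    by rewrite /index_iota subn0; apply: ler_sum => m _; exact: cnt.
  rewrite -mulr_sumr.
  have Z0 m : 0 <= Z m by apply: log2_ge0; rewrite lerDr.
  apply: (@le_trans _ _ (2 * (Z 0%N + \sum_(1 <= m < M.+1 | large m) Z m))).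
    rewrite ler_pM2l // big_mkcond big_nat_recl //= [in leRHS]big_mkcond big_add1 /=.
    by rewrite lerD2r; case: ifP.
  have : \sum_(1 <= m < M.+1 | large m) Z m <= e0 / 20 * M%:R.
    by apply: (hM M); rewrite /= /M; lia.
  rewrite /M natrD natrM; lra.
have dens : 1 - e0 / 2 <= lower_density R B.
  have Zb : 0 <= 2 * Z 0%N + 3 by rewrite addr_ge0 // mulr_ge0 // log2_ge0 // lerDr.
  pose n1 := (Num.truncn ((2 * Z 0%N + 3) * (10 / e0))).+1.
  apply: (@lower_density_ge _ _ _ (maxn M0 n1)) => n.
  rewrite geq_max => /andP[M0n n1n].
  have n0 : (0 < n)%N by apply: leq_trans n1n.
  rewrite ler_pdivlMr ?ltr0n //.
  have := bad n M0n.
  have := count_predC B (iota 1 n); rewrite size_iota => /(congr1 (fun n => n%:R : R)).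
  rewrite natrD.
  have : (2 * Z 0%N + 3) * (10 / e0) <= n%:R.
    have /andP[_ /ltW g] := @truncn_itv _ ((2 * Z 0%N + 3) * (10 / e0)) ltac:(by rewrite mulr_ge0 // divr_ge0 // ltW).
    by apply: le_trans g _; rewrite ler_nat.
  rewrite mulrA ler_pdivrMr //.
  have : 0 < n%:R * e0 by rewrite mulr_gt0 // ltr0n.
  by lra.
have hoo := hB B ltac:(by apply: lt_le_trans dens; lra).
have unb := nneseries_unbounded R B h h0 hoo.
apply: (full_measure R _ t z B h irrational_gt0 irrational_le1 zt
  (inv_nat_gt0 (L.*2.+1)) (inv_nat_le1 _)) => // n /asboolP[m /andP[h1 h2]].
rewrite /large -ltNge => h3.
have {}h3 : (cf_q t m.+1 < L * cf_q t m)%N.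
  by move: h3; rewrite ltr_pdivrMr ?ltr0n ?(cf_q_gt0 R t t01 tirr) // -natrM ltr_nat.
apply: (cf_spread m.+1); first exact: ltnW.
apply: leq_trans (ltnW h3) _; rewrite expnS in h1; nia.
Qed.

End Irrational.

(** * Irrational parameters: part 4 *)

Section NotBadlyApproximable.
Variable R : realType.
Local Notation mu := (@lebesgue_measure R).

Lemma lebesgue_balls_le (l : seq (R * R)) : {in l, forall J, 0 <= J.2} ->
  (mu (balls R l) <= (total_length R l)%:E)%E.
Proof.
elim: l => [|J l IH] l0.
  rewrite /total_length big_nil (_ : balls R [::] = set0) ?measure0 //.
  by apply/seteqP; split => // x [].
rewrite balls_cons /total_length big_cons EFinD.
apply: (@le_trans _ _ (mu [set x : R | (`|x - J.1| <= J.2)%R] + mu (balls R l))%E).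
  by apply: measureU2; [exact: measurable_closed_ball|exact: measurable_balls].
apply: leeD.
  by rewrite -(lebesgue_closed_ball R J.1) // l0 // mem_head.
by apply: IH => K Kl; apply: l0; rewrite inE Kl orbT.
Qed.

Lemma total_length_const (s : seq R) (r : R) :
  total_length R [seq (p, r) | p <- s] = (size s)%:R * (2 * r).
Proof.
by rewrite /total_length big_map /= big_const_seq count_predT iter_addr_0 -[LHS]mulr_natl.
Qed.

Lemma unbounded_nneseries (h : nat -> R) : (forall n, 0 <= h n) ->
  (forall A, exists X, A <= \sum_(1 <= n < X) h n) ->
  (\sum_(1 <= n <oo) (h n)%:E)%E = +oo%E.
Proof.
move=> h0 unb; apply: eq_infty => A; have [X hX] := unb A.
apply: le_trans (nneseries_lim_ge X _); last by move=> n _ _; rewrite lee_fin.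
by rewrite sumEFin lee_fin.
Qed.

Lemma nneseries_le_bound (u : nat -> \bar R) (C : \bar R) : (forall n, 0 <= u n)%E ->
  (forall X, \sum_(0 <= n < X) u n <= C)%E -> (\sum_(0 <= n <oo) u n <= C)%E.
Proof.
move=> u0 uC; apply: lime_le; first by apply: is_cvg_nneseries.
by apply: nearW => X; exact: uC.
Qed.

Lemma sum_half_pow X : \sum_(0 <= i < X) 2^-1 ^+ i <= 2 :> R.
Proof.
suff -> : \sum_(0 <= i < X) 2^-1 ^+ i = 2 - 2 * 2^-1 ^+ X :> R.
  by rewrite gerBl mulr_ge0 // exprn_ge0.
elim: X => [|X IH]; first by rewrite big_geq // expr0; ring.
by rewrite big_nat_recr //= IH exprS; field.
Qed.

Variable t : R.
Hypotheses (t01 : t \in `[0, 1]) (tirr : ~ is_rational t).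

(* With [k = a q_m + b], the point of [(j, k)] is within [a |q_m t - p_m| / 2^n] of
   the point of [(j + a p_m, b)]. *)
Definition cluster_cover z m n : seq (R * R) :=
  [seq (p, (cf_q t m)%:R^-1 * (cf_q t m.+1)%:R^-1 + (4 ^+ n)^-1) |
     p <- [seq pt t z n u b | u <- iota 0 (3 * 2 ^ n), b <- iota 0 (cf_q t m)]].

(** [|q_m t - p_m| <= 1] and [t <= 1] give [p_m <= q_m + 1]. The resulting factor 2 is why the first
    index in [cluster_cover] runs up to [3 * 2 ^ n]. *)
Lemma cf_p_le m : (cf_p R t m <= 2 * cf_q t m)%N.
Proof.
have h1 := cf_approx R t t01 tirr m.
have q1 : 1 <= (cf_q t m.+1)%:R :> R by rewrite ler1n (cf_q_gt0 R t t01 tirr).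
have q0 : 1 <= (cf_q t m)%:R :> R by rewrite ler1n (cf_q_gt0 R t t01 tirr).
have h2 : `|(cf_q t m)%:R * t - (cf_p R t m)%:R| <= 1.
  by apply: le_trans h1 _; rewrite invf_le1 // (lt_le_trans _ q1).
have ht : (cf_q t m)%:R * t <= (cf_q t m)%:R.
  by rewrite ler_piMr // irrational_le1.
move: h2; rewrite ler_norml => /andP[h2 _].
rewrite -(ler_nat R) natrM; lra.
Qed.

(** Here [a <= 2 ^ n / q_m] and [|q_m t - p_m| <= 1 / q_{m+1}], so moving to the representative
    costs at most [1 / (q_m q_{m+1})]; [4 ^- n] is the radius of the original ball. *)
Lemma level_sub_cluster z m n :
  level R t z n (4 ^+ n)^-1 `<=` balls R (cluster_cover z m n).
Proof.
move=> x /levelP[j [k [hj hk hx]]].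
have q0 := cf_q_gt0 R t t01 tirr m.
have q0' := cf_q_gt0 R t t01 tirr m.+1.
set q := cf_q t m in q0 *; set q' := cf_q t m.+1 in q0' *.
pose a := (k %/ q)%N; pose b := (k %% q)%N.
have kE : k = (a * q + b)%N by exact: divn_eq.
have pq := cf_p_le m; set p := cf_p R t m in pq.
exists (pt t z n (j + a * p) b, q%:R^-1 * q'%:R^-1 + (4 ^+ n)^-1) => /=.
  apply/mapP; exists (pt t z n (j + a * p) b) => //.
  apply/allpairsP; exists ((j + a * p)%N, b); rewrite !mem_iota !add0n /=; split => //.
    have : (a * p <= 2 * (a * q))%N by rewrite mulnCA leq_mul2l pq orbT.
    have : (a * q <= k)%N by rewrite kE leq_addr.
    by lia.
  by rewrite ltn_mod.
apply: le_trans (ler_distD (pt t z n j k) _ _) _; rewrite addrC; apply: lerD => //.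
have N0 : 0 < 2 ^+ n :> R by rewrite exprn_gt0.
have -> : pt t z n j k - pt t z n (j + a * p) b = a%:R * (q%:R * t - p%:R) / 2 ^+ n.
  rewrite /pt -mulrBl {1}kE !natrD !natrM; congr (_ / _); ring.
have qR : 0 < q%:R :> R by rewrite ltr0n.
rewrite !normrM normfV (gtr0_norm N0) normr_nat ler_pdivrMr //.
apply: le_trans (ler_wpM2l (ler0n _ _) (cf_approx R t t01 tirr m)) _.
rewrite -/q' -[leRHS]mulrA mulrCA [leRHS]mulrC ler_pM2r ?invr_gt0 ?ltr0n //.
rewrite mulrC ler_pdivlMr // -natrX -natrM ler_nat.
by apply: leq_trans (ltnW hk); rewrite kE leq_addr.
Qed.

(** The level sits between the denominators: [2 ^ i q_m <= 2 ^ n <= 2 * 2 ^ i q_m], while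
    [q_{m+1} >= 4 ^ i q_m]. The length is [6 (2 ^ n / q_{m+1} + q_m / 2 ^ n)], at most [6 (2 + 1)]
    times [2 ^- i]. *)
Lemma cluster_cover_length z m i : (4 ^ i <= cf_digit t m.+1)%N ->
  total_length R (cluster_cover z m (i.+1 + trunc_log 2 (cf_q t m))) <= 18 * 2^-1 ^+ i.
Proof.
move=> hd; rewrite total_length_const size_allpairs !size_iota.
have q0 := cf_q_gt0 R t t01 tirr m.
have q0' := cf_q_gt0 R t t01 tirr m.+1.
have hq := cf_q_ge_digit R t m.
set q := cf_q t m in q0 hq *; set q' := cf_q t m.+1 in hq q0' *.
have /andP[h1 h2] := trunc_log_bounds (isT : 1 < 2)%N q0.
set n := (i.+1 + _)%N.
have N1 : (2 ^ n <= 2 * 2 ^ i * q)%N by rewrite /n expnD expnS leq_mul2l h1 orbT.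
have N2 : (2 ^ i * q <= 2 ^ n)%N.
  by rewrite /n addSnnS expnD leq_mul2l ltnW ?orbT.
have q'1 : (4 ^ i * q <= q')%N by apply: leq_trans hq; rewrite leq_mul2r hd orbT.
have N0 : 0 < 2 ^+ n :> R by rewrite exprn_gt0.
have I0 : 0 < 2 ^+ i :> R by rewrite exprn_gt0.
have qR : 0 < q%:R :> R by rewrite ltr0n.
have qR' : 0 < q'%:R :> R by rewrite ltr0n.
rewrite !natrM natrX expr4E exprVn.
rewrite [leLHS](_ : _ = 6 * (2 ^+ n / q'%:R + q%:R / 2 ^+ n)); last first.
  by field; rewrite !gt_eqF.
have b1 : 2 ^+ n / q'%:R <= 2 * (2 ^+ i)^-1 :> R.
  rewrite ler_pdivrMr // mulrAC ler_pdivlMr //.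
  rewrite -!natrX -!natrM ler_nat.
  apply: leq_trans (leq_mul N1 (leqnn _)) _.
  rewrite -!mulnA leq_mul2l /=; apply: leq_trans q'1.
  by rewrite -[4%N]/(2 * 2)%N expnMn; nia.
have b2 : q%:R / 2 ^+ n <= (2 ^+ i)^-1 :> R.
  rewrite ler_pdivrMr // mulrC ler_pdivlMr // -!natrX -natrM ler_nat mulnC //.
lra.
Qed.

Lemma not_badly_approximable_null : ~ badly_approximable t ->
  exists h : nat -> R, (forall n, 0 <= h n) /\
    (\sum_(1 <= n <oo) (h n)%:E)%E = +oo%E /\
    (forall z : R, z \in `[0, 1 + t] -> mu.-negligible (U t z h)).
Proof.
move=> nba.
have big C : exists m, (C < cf_digit t m.+1)%N.
  apply: contrapT => /forallNP hC; apply: nba; split => //; exists C => -[//|m].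
  by rewrite leqNgt; apply/negP/hC.
have /choice[m hm] : forall i, exists m, (4 ^ i <= cf_digit t m.+1)%N.
  by move=> i; have [m /ltnW hm] := big (4 ^ i)%N; exists m.
pose N i := (i.+1 + trunc_log 2 (cf_q t (m i)))%N.
pose B n := `[< exists i, n = N i >].
exists (fun n => (B n)%:R); split; first by [].
split.
  apply: unbounded_nneseries => // A.
  have infB K : exists2 n, (K <= n)%N & B n.
    by exists (N K); [rewrite /N; lia | apply/asboolP; exists K].
  have [X hX] := count_iota_unbounded B infB (Num.truncn A).+1.
  exists X.+1; have := hX X.+1 (leqnSn _).
  have B0 : B 0%N = false by apply/asboolP => -[i]; rewrite /N; lia.
  rewrite /= B0 add0n => hc.
  have -> : \sum_(1 <= n < X.+1) (B n)%:R = (count B (iota 1 X))%:R :> R.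
    by rewrite -sum1_count natr_sum [in RHS]big_mkcond /index_iota subn1 /=; apply: eq_bigr => n _; case: (B n).
  have [A0|A0] := leP 0 A; last by apply: le_trans (ltW A0) _.
  have /andP[_ /ltW h1] := truncn_itv A0.
  by apply: le_trans h1 _; rewrite ler_nat.
move=> z zt.
pose F i := balls R (cluster_cover z (m i) (N i)).
have F0 : mu (lim_sup_set F) = 0%E.
  apply: lim_sup_set_cvg0 => [k|]; first exact: measurable_balls.
  apply: (@le_lt_trans _ _ (36 : R)%:E); last exact: ltry.
  apply: nneseries_le_bound => [n|X]; first exact: measure_ge0.
  apply: (@le_trans _ _ (\sum_(0 <= i < X) (18 * 2^-1 ^+ i)%:E)%E).
    apply: lee_sum => i _; apply: le_trans (lebesgue_balls_le _ _) _.
      by move=> J /mapP[p _ ->] /=; rewrite addr_ge0 ?mulr_ge0 ?invr_ge0 ?exprn_ge0.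
    by rewrite lee_fin; exact: cluster_cover_length.
  by rewrite sumEFin lee_fin -mulr_sumr; have := sum_half_pow X; lra.
have nF : mu.-negligible (lim_sup_set F).
  exists (lim_sup_set F); split => //.
  apply: bigcap_measurable => [|k _]; first by exists 0%N.
  by apply: bigcup_measurable => i _; exact: measurable_balls.
have n0 k : mu.-negligible (level R t z k 0).
  exists (level R t z k 0); split => //; first exact: measurable_level.
  apply/eqP; rewrite eq_le measure_ge0 andbT.
  apply: le_trans (lebesgue_balls_le _ _) _; first by move=> J /allpairsP[? [_ _ ->]].
  rewrite /total_length big1_seq // => J /andP[_ /allpairsP[? [_ _ ->]]] /=.
  by rewrite mulr0.
apply: negligibleS (negligibleU nF (negligible_bigcup n0)) => x /U_tail_hits hx.
(* Where [h n = 0], the set [U] still contains the level-[n] points themselves. *)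
have [ex|nex] := pselect (exists k, level R t z k 0 x).
  by right; have [k hk] := ex; exists k.
left => K _ /=.
(* The [N i] need not increase. Beyond all [N i] with [i < K], a level in [B] must be some [N i]
   with [i >= K]. *)
have [n /= Kn] := hx (\max_(i < K) (N i).+1)%N.
case: (boolP (B n)) => [/asboolP[i nE]|_]; last first.
  by rewrite mul0r => hn; exfalso; apply: nex; exists n.
rewrite mul1r => hn; exists i => /=.
  rewrite leqNgt; apply/negP => iK.
  have := leq_bigmax (F := fun i : 'I_K => (N i).+1) (Ordinal iK).
  by move=> /leq_trans/(_ Kn); rewrite /= nE ltnn.
by rewrite /F -nE; apply: level_sub_cluster.
Qed.

End NotBadlyApproximable.

(** * Rational parameters *)

Section Dimension.
Variable R : realType.

Lemma diam_closed_ball (A : set R) (c r : R) : 0 <= r ->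
  A `<=` [set x | `|x - c| <= r] -> (diam A <= (2 * r)%:E)%E.
Proof.
move=> r0 Ac; apply: ge_ereal_sup => _ [[x y] [/= Ax Ay] <-].
rewrite lee_fin; have := Ac _ Ax; have := Ac _ Ay => /= h1 h2.
have := ler_distD c x y; rewrite [`|c - y|]distrC; lra.
Qed.

Lemma hcost_ge0 (s : R) A : (0 <= hcost s A)%E.
Proof. by rewrite /hcost; case: pselect => h //; rewrite lee_fin powR_ge0. Qed.

Lemma hcost_le (s d : R) A : 0 <= s -> (diam A <= d%:E)%E -> (hcost s A <= (d `^ s)%:E)%E.
Proof.
move=> s0 dA; rewrite /hcost; case: pselect => nA; first by rewrite lee_fin powR_ge0.
have /set0P[x Ax] : A != set0 by apply/eqP.
have d0 : (0 <= diam A)%E.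
  by apply: ereal_sup_ubound; exists (x, x) => //=; rewrite subrr normr0.
have df : diam A \is a fin_num by rewrite ge0_fin_numE // (le_lt_trans dA) // ltry.
have fd : 0 <= fine (diam A) <= d.
  by rewrite -!lee_fin fineK // d0.
have /andP[f0 fd'] := fd.
by rewrite lee_fin ge0_ler_powR // nnegrE ?(le_trans f0 fd').
Qed.

(** A discrete integral comparison for [i ^ (-3/2)]: with [b ^ 2 = a ^ 2 + 1] one has
    [1 / a - 1 / b = 1 / (a b (a + b))], and [a <= b]. It serves the dimension bound and the
    cylinder lengths alike. *)
Lemma inv_cube_telescope (i : nat) : (2 <= i)%N ->
  (Num.sqrt (i%:R : R) ^+ 3)^-1 <= 2 * ((Num.sqrt (i.-1%:R : R))^-1 - (Num.sqrt i%:R)^-1).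
Proof.
case: i => [|[|i]] // _; rewrite [_.-1]/=.
set a := Num.sqrt i.+1%:R; set b := Num.sqrt _.
have a0 : 0 < a by rewrite sqrtr_gt0.
have ab : a <= b by rewrite ler_wsqrtr // ler_nat.
have b0 : 0 < b by exact: lt_le_trans ab.
have hb : b * b = a * a + 1 by rewrite -!expr2 !sqr_sqrtr // natr1.
have dab : (b - a) * (a + b) = 1 by rewrite (_ : _ * _ = b * b - a * a); [rewrite hb; ring | ring].
have dbb : 0 <= (b - a) * b * (b - a) by rewrite !mulr_ge0 ?subr_ge0 // ltW.
rewrite -[leLHS]mul1r ler_pdivrMr ?exprn_gt0 //.
rewrite (_ : 2 * _ * _ = 2 * (b - a) * b ^+ 2 / a); last by field; rewrite !gt_eqF.
rewrite ler_pdivlMr // mul1r.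
have : b * ((b - a) * (a + b)) = b by rewrite dab mulr1.
by lra.
Qed.

Lemma sum_inv_cube_le (i0 X : nat) : (1 <= i0)%N ->
  \sum_(0 <= i < X) (if (i0 < i)%N then (Num.sqrt (i%:R : R) ^+ 3)^-1 else 0) <=
    2 * (Num.sqrt i0%:R)^-1.
Proof.
move=> i01.
suff : \sum_(0 <= i < X.+1) (if (i0 < i)%N then (Num.sqrt (i%:R : R) ^+ 3)^-1 else 0) <=
    if (i0 < X)%N then 2 * ((Num.sqrt i0%:R)^-1 - (Num.sqrt X%:R)^-1) else 0.
  rewrite big_nat_recr //= => h.
  have h1 : 0 <= (if (i0 < X)%N then (Num.sqrt (X%:R : R) ^+ 3)^-1 else 0).
    by case: ifP => // _; rewrite invr_ge0 exprn_ge0 // sqrtr_ge0.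
  have h2 : 0 <= (Num.sqrt (i0%:R : R))^-1 by rewrite invr_ge0 sqrtr_ge0.
  have h3 : 0 <= (Num.sqrt (X%:R : R))^-1 by rewrite invr_ge0 sqrtr_ge0.
  by move: h h1; case: ifP => _; lra.
elim: X => [|X IH]; first by rewrite big_nat1 !ltn0.
rewrite big_nat_recr //=.
case: (ltnP i0 X.+1) => iX; last first.
  by rewrite addr0; apply: le_trans IH _; rewrite ltnNge ltnW.
have := inv_cube_telescope X.+1 (leq_ltn_trans i01 iX); rewrite [_.-1]/= => ht.
move: iX IH ht; rewrite ltnS leq_eqVlt => /orP[/eqP <-|iX].
  by rewrite ltnn => IH ht; lra.
by rewrite iX => IH ht; lra.
Qed.

(** With [t = p / q] the points of level [n] are [(z + m / q) / 2 ^ n] with [m < 2 ^ (n + s)]. One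
    index [i = 2 ^ (n + s) + m] lists all levels: its leading bit encodes [n], the rest is [m]. Then
    [4 ^- n] is of order [i ^ -2], and its power 3/4 is of order [i ^ (-3/2)], which is summable. *)
Lemma rational_dim_lt1 (t : R) : t \in `[0, 1] -> is_rational t ->
  forall z : R, z \in `[0, 1 + t] -> (hausdorff_dim (U t z (fun=> 1%R)) < 1%:E)%E.
Proof.
move=> t01 trat z _.
have [p [q [q0 pq tE]]] := rational_unitP R t t01 trat.
have qR : (q%:R : R) != 0 by rewrite pnatr_eq0 -lt0n.
pose s := (2 * q)%N.
have hs : (2 * q <= 2 ^ s)%N by exact/ltnW/ltn_expl.
pose lev i := (trunc_log 2 i - s)%N.
pose ctr i : R := (z + (i - 2 ^ trunc_log 2 i)%N%:R / q%:R) / 2 ^+ lev i.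
(* From [i < 2 * 2 ^ (n + s)] comes [i ^ 2 <= 4 * 4 ^ s * 4 ^ n]; the diameter [2 * 4 ^- n] brings
   another 2. *)
pose K : R := 8 * 4 ^+ s.
have K0 : 0 < K by rewrite mulr_gt0 // exprn_gt0.
have radius i : (0 < i)%N -> 2 * (4 ^+ lev i)^-1 <= K / i%:R ^+ 2.
  move=> i0; have /andP[h1 h2] := trunc_log_bounds (isT : 1 < 2)%N i0.
  have h3 : i%:R <= 2 ^+ s * (2 * 2 ^+ lev i) :> R.
    rewrite -exprS -exprD -natrX ler_nat; apply: leq_trans (ltnW h2) _.
    by rewrite leq_exp2l // /lev; lia.
  have L0 : 0 < 2 ^+ lev i :> R by rewrite exprn_gt0.
  have iR : 0 < i%:R :> R by rewrite ltr0n.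
  rewrite ler_pdivlMr ?exprn_gt0 // -mulrA mulrC -ler_pdivlMr //.
  rewrite mulrC ler_pdivrMr ?exprn_gt0 // /K !expr4E.
  have := ler_pM (ltW iR) (ltW iR) h3 h3; rewrite -expr2.
  by lra.
pose sets I0 i : set R := if (I0 < i)%N then [set x | `|x - ctr i| <= (4 ^+ lev i)^-1] else set0.
have cover I0 : U t z (fun=> 1 : R) `<=` \bigcup_i sets I0 i.
  move=> x /U_ptP /(_ I0.+1)[n I0n [j [k [hj hk hx]]]].
  pose m := (j * q + k * p)%N.
  have hm : (m < 2 ^ (n + s))%N.
    rewrite /m expnD; apply: (@leq_trans (2 ^ n * (2 * q))%N); last by rewrite leq_mul2l hs orbT.
    by nia.
  have hl : trunc_log 2 (2 ^ (n + s) + m) = (n + s)%N.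
    by apply: trunc_log_eq => //; rewrite leq_addr expnS; lia.
  exists (2 ^ (n + s) + m)%N => //; rewrite /sets ifT; last first.
    apply: leq_trans I0n _; apply: leq_trans (leq_addr _ _).
    by apply: leq_trans (leq_addr s n) _; exact/ltnW/ltn_expl.
  rewrite /= /ctr /lev hl addnK addKn.
  rewrite mul1r in hx; congr (`|x - _| <= _): hx; rewrite /pt /m tE natrD !natrM.
  by congr (_ / _); field.
have contents d I0 : 0 < d -> (1 <= I0)%N -> K / I0%:R <= d ->
    (hausdorff_content (3 / 4) d (U t z (fun=> 1%R)) <= (K `^ (3 / 4) * (2 * (Num.sqrt I0%:R)^-1))%:E)%E.
  move=> d0 I01 hd.
  have I0R : 0 < I0%:R :> R by rewrite ltr0n.
  have dsets i : (I0 < i)%N -> (diam (sets I0 i) <= (K / i%:R ^+ 2)%:E)%E.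
    move=> iI; apply: (@le_trans _ _ (2 * (4 ^+ lev i)^-1)%:E).
      apply: (@diam_closed_ball _ (ctr i)); first by rewrite invr_ge0 exprn_ge0.
      by rewrite /sets iI.
    by rewrite lee_fin radius //; lia.
  apply: ge_ereal_inf; eexists.
    exists (sets I0); last reflexivity.
    split; first exact: cover.
    move=> i; case: (ltnP I0 i) => iI; last first.
      rewrite /sets ltnNge iI /= (_ : diam _ = -oo%E) ?leNye //.
      rewrite /diam (_ : [set _ | _ in _] = set0) ?ereal_sup0 //.
      by apply/seteqP; split => // _ [x [[]]].
    apply: le_trans (dsets i iI) _; rewrite lee_fin; apply: le_trans hd.
    rewrite ler_pM2l // lef_pV2 ?posrE ?exprn_gt0 ?ltr0n //; last by lia.
    by rewrite -natrX ler_nat expnS; nia.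
  apply: nneseries_le_bound => [i|X]; first exact: hcost_ge0.
  apply: (@le_trans _ _ (\sum_(0 <= i < X) (K `^ (3 / 4) *
     (if (I0 < i)%N then (Num.sqrt (i%:R : R) ^+ 3)^-1 else 0))%:E)%E).
    apply: lee_sum => i _; case: (ltnP I0 i) => iI; last first.
      rewrite /sets ltnNge iI /= mulr0 /hcost.
      by case: pselect => [h|[]].
    have s0 : 0 < Num.sqrt (i%:R : R) by rewrite sqrtr_gt0 ltr0n; lia.
    apply: le_trans (hcost_le _ _ _ _ (dsets i iI)) _ => //.
    rewrite lee_fin powRM ?(ltW K0) ?invr_ge0 ?exprn_ge0 //.
    have si : 0 <= (Num.sqrt (i%:R : R))^-1 by rewrite invr_ge0 ltW.
    have -> : (i%:R ^+ 2)^-1 = (Num.sqrt (i%:R : R))^-1 `^ 4%:R.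
      by rewrite powR_mulrn // exprVn (exprM _ 2 2) sqr_sqrtr.
    have e3 : 4%:R * (3 / 4) = 3%:R :> R by field.
    by rewrite -powRrM e3 powR_mulrn // exprVn.
  rewrite sumEFin lee_fin -mulr_sumr ler_pM2l ?powR_gt0 //.
  exact: sum_inv_cube_le.
have content0 d : 0 < d -> hausdorff_content (3 / 4) d (U t z (fun=> 1)) = 0%E.
  move=> d0; apply/eqP; rewrite eq_le; apply/andP; split; last first.
    by apply: le_ereal_inf_tmp => _ [F _ <-]; apply: nneseries_ge0 => i _ _; exact: hcost_ge0.
  apply/lee_addgt0Pr => e e0; rewrite add0e.
  pose C := 2 * K `^ (3 / 4).
  have C0 : 0 < C by rewrite mulr_gt0 ?powR_gt0.
  (* [K / d] brings the diameters down to [d], [(C / e) ^ 2] the total cost down to [e]. *)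
  pose I0 := (Num.truncn (K / d + (C / e) ^+ 2)).+1.
  have h0 : 0 <= K / d by rewrite divr_ge0 // ltW.
  have h1 : 0 <= (C / e) ^+ 2 by rewrite sqr_ge0.
  have /andP[_ /ltW hI] := truncn_itv (addr_ge0 h0 h1).
  rewrite -/I0 in hI.
  have I0R : 0 < I0%:R :> R by rewrite ltr0n.
  apply: le_trans (contents d I0 d0 _ _) _ => //.
    by rewrite ler_pdivrMr // mulrC -ler_pdivrMr //; lra.
  rewrite lee_fin (_ : _ * _ = C / Num.sqrt I0%:R); last by rewrite /C; ring.
  rewrite ler_pdivrMr ?sqrtr_gt0 // mulrC -ler_pdivrMr //.
  rewrite -[leLHS](ger0_norm (ltW (divr_gt0 C0 e0))) -sqrtr_sqr ler_wsqrtr //; lra.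
apply: (@le_lt_trans _ _ (3 / 4 : R)%:E); last by rewrite lte_fin; lra.
apply: ereal_inf_lbound; exists (3 / 4) => //; split; first by lra.
apply/eqP; rewrite eq_le; apply/andP; split.
  by apply: ge_ereal_sup => _ [d /= d0 <-]; rewrite content0.
by apply: ereal_sup_ubound; exists 1 => //=; rewrite content0.
Qed.

End Dimension.

(** * Maximal ergodic inequality *)

Section MaximalInequality.

(** Scan from the left: step over an index outside [P], jump over the whole window at an index in
    [P]. The windows used are disjoint and each pays for all indices it covers; the [N] extra terms
    house a last window that overruns. *)
Lemma window_count_le (R : realType) (a : nat -> R) (e : R) (N : nat) (P : pred nat) :
  0 <= e -> (forall i, 0 <= a i) ->
  (forall i, P i -> exists2 M, (0 < M <= N)%N & e * M%:R <= \sum_(i <= j < i + M) a j) ->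
  forall K i, e * (count P (iota i K))%:R <= \sum_(i <= j < i + K + N) a j.
Proof.
move=> e0 a0 HP K; have [n] := ubnP K; elim: n K => // n IH K Kn i.
case: K Kn => [|K] Kn; first by rewrite /= mulr0 sumr_ge0.
case: (boolP (P i)) => Pi; last first.
  rewrite /= (negbTE Pi) add0n; apply: le_trans (IH K _ i.+1) _; first by [].
  rewrite [leRHS]big_ltn; last by lia.
  by rewrite addSnnS lerDr.
have [M /andP[M0 MN] hM] := HP i Pi.
have [MK|KM] := leqP M K.+1; last first.
  apply: (@le_trans _ _ (e * M%:R)).
    rewrite ler_wpM2l // ler_nat; apply: leq_trans (count_size _ _) _.
    by rewrite size_iota ltnW.
  apply: le_trans hM _; rewrite [leRHS](big_cat_nat (n := i + M)) ?leq_addr //=; last by lia.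
  by rewrite lerDl sumr_ge0.
rewrite -(subnKC MK) iotaD count_cat natrD mulrDr.
rewrite [leRHS](big_cat_nat (n := i + M)) ?leq_addr //=; last by lia.
apply: lerD.
  apply: le_trans hM; rewrite ler_wpM2l // ler_nat.
  by apply: leq_trans (count_size _ _) _; rewrite size_iota.
by apply: le_trans (IH (K.+1 - M)%N _ (i + M)%N) _; [lia|rewrite addnA].
Qed.

Context d (T : measurableType d) (R : realType) (mu : probability T R).
Variables (tau : T -> T) (f : T -> R).
Hypotheses (mtau : measurable_fun setT tau).
Hypothesis inv : forall A, measurable A -> mu (tau @^-1` A) = mu A.
Hypotheses (mf : measurable_fun setT f) (f0 : forall x, 0 <= f x).

Let mtaun n : measurable_fun setT (iter n tau).
Proof. elim: n => [|n IH] /=; [exact: measurable_id | exact: measurableT_comp]. Qed.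

Let invn n A : measurable A -> mu (iter n tau @^-1` A) = mu A.
Proof.
elim: n A => [//|n IH] A mA.
rewrite -(inv A mA) -(IH (tau @^-1` A)) //.
by have := mtau measurableT A mA; rewrite setTI.
Qed.

Let S M x := \sum_(0 <= i < M) f (iter i tau x).

Let mS M : measurable_fun setT (S M).
Proof.
by apply: measurable_sum => i; exact: measurableT_comp.
Qed.

Definition exceed (e : R) N : set T := [set x | exists2 M, (0 < M <= N)%N & e * M%:R < S M x].

Lemma measurable_exceed e N : measurable (exceed e N).
Proof.
rewrite (_ : exceed e N = \bigcup_(M in [set M | (0 < M <= N)%N]) (S M @^-1` `]e * M%:R, +oo[%classic)).
  apply: bigcup_measurable => M _; rewrite -[X in measurable X]setTI.
  by apply: mS => //; exact: measurable_itv.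
apply/seteqP; split => x [M MN hM]; exists M => //.
  by rewrite /= in_itv /= andbT.
by move: hM; rewrite /= in_itv /= andbT.
Qed.

Let int_iter n : (\int[mu]_x (f (iter n tau x))%:E = \int[mu]_x (f x)%:E)%E.
Proof.
have := @ge0_integral_pushforward _ _ T T R _ (mtaun n) mu setT (EFin \o f) measurableT.
rewrite preimage_setT => <- //.
- apply: eq_measure_integral => A mA _; exact: invn.
- exact/measurable_EFinP.
- by move=> x _; rewrite lee_fin.
Qed.

(** Apply [window_count_le] along each orbit and integrate. By invariance
    [K e mu (exceed e N) <= (K + N) I] with [I] the integral of [f]; for large [K] the surplus [N]
    is negligible. *)
Lemma maximal_inequality (e : R) N : 0 < e ->
  (e%:E * mu (exceed e N) <= \int[mu]_x (f x)%:E)%E.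
Proof.
move=> e0; set I := (\int[mu]_x (f x)%:E)%E.
have I0 : (0 <= I)%E by apply: integral_ge0 => x _; rewrite lee_fin.
have mA := measurable_exceed e N.
have key K : (K%:R%:E * (e%:E * mu (exceed e N)) <= (K + N)%:R%:E * I)%E.
  have -> : ((K + N)%:R%:E * I)%E = (\int[mu]_x (\sum_(0 <= i < K + N) (f (iter i tau x))%:E))%E.
    rewrite ge0_integral_sum //; last by move=> i x _; rewrite lee_fin.
      rewrite (eq_bigr (fun=> I)) => [|i _]; last exact: int_iter.
      by rewrite sumr_const_nat subn0 mule_natl.
    by move=> i; apply/measurable_EFinP; exact: measurableT_comp.
  have -> : (K%:R%:E * (e%:E * mu (exceed e N)))%E =
     (\int[mu]_x (\sum_(0 <= i < K) (e * \1_(exceed e N) (iter i tau x))%:E))%E.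
    rewrite ge0_integral_sum //.
    - rewrite (eq_bigr (fun=> (e%:E * mu (exceed e N))%E)) => [|i _].
        by rewrite sumr_const_nat subn0 mule_natl.
      under eq_integral do rewrite EFinM.
      rewrite ge0_integralZl //.
      + congr (_ * _)%E.
        rewrite -(invn i (exceed e N) mA) -[X in _ = mu X]setIT -integral_indic //.
        by have := mtaun i measurableT _ mA; rewrite setTI.
      + by apply/measurable_EFinP; apply: measurableT_comp (mtaun i).
      + by rewrite lee_fin ltW.
    - move=> i; apply/measurable_EFinP; apply: measurable_funM => //.
      exact: measurableT_comp (mtaun i).
    - by move=> i x _; rewrite lee_fin mulr_ge0 // ltW.
  apply: ge0_le_integral => //.
  - by move=> x _; apply: sume_ge0 => i _; rewrite lee_fin mulr_ge0 // ltW.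
  - apply: emeasurable_sum => i; apply/measurable_EFinP; apply: measurable_funM => //.
    exact: measurableT_comp (mtaun i).
  - by apply: emeasurable_sum => i; apply/measurable_EFinP; exact: measurableT_comp.
  move=> x _; rewrite !sumEFin lee_fin -mulr_sumr.
  have := @window_count_le R (fun i => f (iter i tau x)) e N
    (fun i => iter i tau x \in exceed e N) (ltW e0) (fun i => f0 _) _ K 0.
  rewrite add0n => H; apply: le_trans (H _).
    rewrite ler_pM2l // -sum1_count natr_sum /index_iota subn0 [leRHS]big_mkcond /=.
    by apply: ler_sum => i _; rewrite indicE; case: (_ \in _).
  move=> i /set_mem[M MN hM]; exists M => //; apply: le_trans (ltW hM) _.
  rewrite [leRHS](_ : _ = \sum_(0 <= j < M) f (iter (j + i) tau x)).
    by rewrite le_eqVlt; apply/orP; left; apply/eqP/eq_bigr => j _; rewrite iterD.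
  by rewrite -{1}[i]add0n big_addn addKn.
have [Ioo|Ifin] := eqVneq I +oo%E; first by rewrite Ioo leey.
have If : I \is a fin_num by rewrite ge0_fin_numE // ltey.
have muf : mu (exceed e N) \is a fin_num by rewrite fin_num_measure.
move: key; rewrite -(fineK If) -(fineK muf) => key.
rewrite -EFinM lee_fin; set m := fine _ in key *; set J := fine _ in key *.
rewrite leNgt; apply/negP => hlt.
pose K := (Num.truncn (N%:R * J / (e * m - J))).+1.
have := key K; rewrite -!EFinM lee_fin natrD.
have J0 : 0 <= J by rewrite fine_ge0.
have h1 : 0 <= N%:R * J / (e * m - J) by rewrite divr_ge0 ?mulr_ge0 // subr_ge0 ltW.
have /andP[_] := truncn_itv h1; rewrite -/K ltr_pdivrMr ?subr_gt0 //.
by lra.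
Qed.

Lemma maximal_inequality_union (e : R) : 0 < e ->
  (e%:E * mu (\bigcup_N exceed e N) <= \int[mu]_x (f x)%:E)%E.
Proof.
move=> e0.
have cv : mu (exceed e N) @[N --> \oo] --> mu (\bigcup_N exceed e N).
  apply: nondecreasing_cvg_mu.
  - exact: measurable_exceed.
  - by apply: bigcup_measurable => N _; exact: measurable_exceed.
  - move=> N N' NN'; apply/subsetPset => x [M /andP[M0 MN] hM]; exists M => //.
    by rewrite M0 (leq_trans MN).
have cv' : (e%:E * mu (exceed e N))%E @[N --> \oo] --> (e%:E * mu (\bigcup_N exceed e N))%E.
  by apply: cvgeZl.
rewrite -(cvg_lim _ cv') //; apply: lime_le; first by apply/cvg_ex; eexists; exact: cv'.
by apply: nearW => N; exact: maximal_inequality.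
Qed.

End MaximalInequality.

(** * Gauss-invariant measures *)

Section Weight.
Variable R : realType.
Implicit Types (t x : R).

(** Since [q_{m+1} / q_m <= zeta_{m+1} + 1], a ratio of at least [L] forces [L <= zeta_{m+1} + 1].
    This weight thus dominates the terms of the digit condition, and it depends on one digit only,
    hence is a function along the Gauss orbit. *)
Definition weight (L k : nat) : R := if (L <= k.+1)%N then log2 k.+1%:R else 0.

Lemma weight_ge0 L k : 0 <= weight L k.
Proof. by rewrite /weight; case: ifP => // _; apply: log2_ge0; rewrite ler1n. Qed.

Lemma ler_log2 (x y : R) : 0 < x -> x <= y -> log2 x <= log2 y.
Proof.
move=> x0 xy; rewrite /log2 ler_pM2r ?invr_gt0 ?ln_gt0 ?ltr1n //.
by rewrite ler_ln // posrE // (lt_le_trans x0).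
Qed.

Lemma weight_mono L : {homo weight L : k l / (k <= l)%N >-> k <= l}.
Proof.
move=> k l kl; rewrite {1}/weight; case: ifP => Lk; last exact: weight_ge0.
rewrite /weight ifT; last exact: leq_trans Lk _.
by apply: ler_log2; rewrite ?ltr0n // ler_nat.
Qed.

Lemma weight0 L : weight L 0 = 0.
Proof. by rewrite /weight /log2 ln1 mul0r if_same. Qed.

Lemma weight_digit_good t : t \in `[0, 1] -> ~ is_rational t ->
  (forall eps : R, 0 < eps -> exists L M0 : nat, forall M, (M0 <= M)%N ->
     \sum_(1 <= m < M.+1) weight L (cf_digit t m.+1) <= eps * M%:R) ->
  good_param t.
Proof.
move=> t01 tirr H; apply: (digit_condition_good R t t01 tirr) => eps e0.
have [L [M0 hM]] := H eps e0; exists L; exists M0 => // M /= M0M.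
apply: le_trans (hM M M0M); rewrite big_mkcond; apply: ler_sum => m _.
case: ifP => hL; last exact: weight_ge0.
rewrite /weight ifT ?natr1 //.
have q0 := cf_q_gt0 R t t01 tirr m.
rewrite -(ler_nat R); apply: le_trans hL _.
rewrite ler_pdivrMr ?ltr0n // -natrM ler_nat.
exact: cf_q_le_digit.
Qed.

Definition gauss_weight L x : R := weight L (Num.truncn x^-1).

Lemma gauss_weight_ge0 L x : 0 <= gauss_weight L x.
Proof. exact: weight_ge0. Qed.

Lemma measurable_inv : measurable_fun setT (@GRing.inv R).
Proof.
rewrite (_ : [set: R] = [set 0] `|` [set x | x != 0]); last first.
  apply/seteqP; split => // x _ /=; have [->|] := eqVneq x 0; [by left|by right].
have oD : open [set x : R | x != 0] by exact: open_neq.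
apply/measurable_funU => //; first exact: open_measurable.
split; first exact: measurable_fun_set1.
apply: open_continuous_measurable_fun => // x; rewrite inE /= => x0.
exact: inv_continuous.
Qed.

Lemma measurable_gauss : measurable_fun setT (@gauss R).
Proof.
apply: measurable_funB; first exact: measurable_inv.
have mfl : measurable_fun setT (fun y : R => (Num.floor y)%:~R : R).
  by apply: nondecreasing_measurable => // x y xy; rewrite ler_int; apply: le_floor.
exact: (measurableT_comp mfl measurable_inv).
Qed.

Lemma measurable_gauss_weight L : measurable_fun setT (gauss_weight L).
Proof.
have mw : measurable_fun setT (fun y : R => weight L (Num.truncn y)).
  apply: nondecreasing_measurable => // x y xy.
  by apply: weight_mono; exact: le_truncn.
exact: (measurableT_comp mw measurable_inv).
Qed.

(** The Gauss map sends [p / q] to [(q mod p) / p], which is Euclid's algorithm. An invariant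
    measure may have atoms, so countability alone does not make the rationals null; reaching 0, a
    point of measure zero, does. *)
Lemma rational_gauss0 t : t \in `[0, 1] -> is_rational t -> exists i, iter i (@gauss R) t = 0.
Proof.
move=> t01 /(rational_unitP R t t01)[p [q [q0 pq ->]]].
elim/ltn_ind: p q q0 pq => p IH q q0 pq.
have [->|p0] := posnP p; first by exists 0%N; rewrite /= mul0r.
have [i hi] := IH (q %% p)%N (ltn_pmod _ p0) p p0 (ltnW (ltn_pmod _ p0)).
exists i.+1; rewrite iterSr -hi; congr iter.
have pR : (p%:R : R) != 0 by rewrite pnatr_eq0 -lt0n.
have fE : Num.floor (q%:R / p%:R : R) = (q %/ p)%N.
  apply: floor_def; rewrite -pmulrn intrD -pmulrn ler_pdivlMr ?ltr0n //.
  rewrite ltr_pdivrMr ?ltr0n // natr1 -!natrM ler_nat ltr_nat leq_divM /=.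
  exact: ltn_ceil.
rewrite /gauss invf_div fE -pmulrn {1}(divn_eq q p) natrD natrM.
by field.
Qed.

End Weight.

Section GaussErgodic.
Variable R : realType.
Variable mu : probability (measurableTypeR R) R.
Hypothesis mu01 : mu (`]0, 1]%classic) = 1%E.
Hypothesis muinv : forall A : set R, measurable A ->
     mu [set x | 0 < x <= 1 /\ A (gauss x)] = mu A.
Hypothesis musum : (\sum_(1 <= m <oo)
        (mu `[(m.+1%:R)^-1%R, (m%:R)^-1%R]%classic * (log2 m.+1%:R)%:E) < +oo)%E.

(** Invariance is given on []0, 1]], whereas the maximal inequality takes preimages in all of [R];
    the difference is null. *)
Lemma gauss_invariant (A : set R) : measurable A -> mu (@gauss R @^-1` A) = mu A.
Proof.
move=> mA; rewrite -(muinv A mA).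
have mgA : measurable (@gauss R @^-1` A).
  by have := measurable_gauss R measurableT A mA; rewrite setTI.
have m01 : measurable (`]0, 1]%classic : set R) by exact: measurable_itv.
rewrite (_ : [set x | _ /\ _] = @gauss R @^-1` A `&` `]0, 1]%classic); last first.
  by apply/seteqP; split => x /=; rewrite in_itv /= => -[].
have m0 : mu (~` `]0, 1]%classic) = 0%E.
  by rewrite probability_setC // [X in (_ - X)%E]mu01 subee.
apply/eqP; rewrite eq_le; apply/andP; split; last first.
  by apply: le_measure; rewrite ?inE //; (exact: measurableI || exact: subIsetl).
rewrite -[leRHS]adde0 -m0.
apply: le_trans (measureU2 _ _ _); [|exact: measurableI|exact: measurableC].
apply: le_measure; rewrite ?inE //.
  by apply: measurableU; (exact: measurableI || exact: measurableC).
by move=> x gx /=; have [h|h] := pselect (`]0, 1]%classic x); [left|right].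
Qed.

Lemma integral_gauss_weight_le L :
  (\int[mu]_x (gauss_weight R L x)%:E <=
   \sum_(0 <= m <oo) (weight R L m)%:E * mu `[(m.+1%:R)^-1%R, (m%:R)^-1%R]%classic)%E.
Proof.
have mitv m : measurable (`[(m.+1%:R)^-1%R, (m%:R)^-1%R]%classic : set R) by exact: measurable_itv.
have -> : (\sum_(0 <= m <oo) (weight R L m)%:E * mu `[(m.+1%:R)^-1%R, (m%:R)^-1%R]%classic)%E =
  (\int[mu]_x \sum_(0 <= m <oo) (weight R L m * \1_(`[(m.+1%:R)^-1%R, (m%:R)^-1%R]%classic) x)%:E)%E.
  rewrite integral_nneseries //.
  - apply: eq_eseriesr => m _.
    under [RHS]eq_integral do rewrite EFinM.
    rewrite ge0_integralZl //.
    + by rewrite integral_indic // setIT.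
    + by apply/measurable_EFinP.
    + by rewrite lee_fin weight_ge0.
  - by move=> m; apply/measurable_EFinP; apply: measurable_funM.
  - by move=> m x _; rewrite lee_fin mulr_ge0 // weight_ge0.
apply: ge0_le_integral => //.
- by move=> x _; rewrite lee_fin gauss_weight_ge0.
- by apply/measurable_EFinP; exact: measurable_gauss_weight.
- apply: ge0_emeasurable_sum => [m x _|m _]; first by rewrite lee_fin mulr_ge0 // weight_ge0.
  by apply/measurable_EFinP; apply: measurable_funM.
move=> x _; rewrite /gauss_weight; set k := Num.truncn _.
have [k0|k0] := posnP k.
  by rewrite k0 weight0; apply: nneseries_ge0 => m _ _; rewrite lee_fin mulr_ge0 // weight_ge0.
have : (\sum_(0 <= m < k.+1) (weight R L m * \1_(`[(m.+1%:R)^-1%R, (m%:R)^-1%R]%classic) x)%:E <=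
  \sum_(0 <= m <oo) (weight R L m * \1_(`[(m.+1%:R)^-1%R, (m%:R)^-1%R]%classic) x)%:E)%E.
  by apply: nneseries_lim_ge => m _ _; rewrite lee_fin mulr_ge0 // weight_ge0.
apply: le_trans; rewrite big_nat_recr //=.
have hx : 1 <= x^-1 by move: k0; rewrite /k truncn_gt0.
have x0 : 0 < x by rewrite -invr_gt0; exact: lt_le_trans hx.
have /andP[h1 h2] := truncn_itv (le_trans ler01 hx); rewrite -/k in h1 h2.
rewrite [X in (_ <= _ + X)%E](_ : _ = (weight R L k)%:E); last first.
  rewrite indicE mem_set ?mulr1 //= in_itv /=; apply/andP; split.
    by rewrite -[leRHS]invrK lef_pV2 ?posrE ?ltr0n ?invr_gt0 // ltW.
  by rewrite -[leLHS]invrK lef_pV2 ?posrE ?ltr0n ?invr_gt0.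
by rewrite leeDr //; apply: sume_ge0 => m _; rewrite lee_fin mulr_ge0 // weight_ge0.
Qed.

Lemma tail_small (eta : R) : 0 < eta -> exists L, (\int[mu]_x (gauss_weight R L x)%:E < eta%:E)%E.
Proof.
move=> eta0.
pose u m : \bar R := (mu `[(m.+1%:R)^-1%R, (m%:R)^-1%R]%classic * (log2 m.+1%:R)%:E)%E.
have u0 m : (0 <= u m)%E by rewrite /u mule_ge0 // lee_fin log2_ge0 // ler1n.
have cv : (\sum_(N <= m <oo | (0 < m)%N) u m)%E @[N --> \oo] --> 0%E.
  apply: nneseries_tail_cvg => [|k _]; last exact: u0.
  move: musum; rewrite eseries_cond; apply: le_lt_trans.
  by rewrite le_eqVlt; apply/orP; left; apply/eqP/eq_eseriesl => m.
have [N _ hN] : \forall N \near \oo, (\sum_(N <= m <oo | (0 < m)%N) u m < eta%:E)%E.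
  have nb : nbhs (0%E : \bar R) [set y | (y < eta%:E)%E].
    apply: open_nbhs_nbhs; split; first exact: open_ereal_lt_ereal.
    by rewrite /= lte_fin.
  exact: (cv _ nb).
exists N.+1; apply: le_lt_trans (hN N (leqnn _)).
apply: le_trans (integral_gauss_weight_le _) _.
rewrite [leRHS]eseries_cond.
rewrite [leRHS]eseries_mkcond; apply: lee_nneseries => [m _ _|m _].
  by rewrite mule_ge0 // lee_fin weight_ge0.
rewrite /weight; case: (posnP m) => [->|m0] /=.
  by rewrite /log2 ln1 mul0r if_same mul0e.
by rewrite ltnS; case: ifP => hm; rewrite ?mul0e // /u muleC.
Qed.

(** The maximal inequality bounds [mu (Bad k L)] by [k + 1] times the integral of [gauss_weight L],
    which can be made arbitrarily small. So for almost every [t] and every [k] some [L] keeps all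
    orbit averages at most [1 / (k + 1)]. *)
Lemma gauss_good : mu.-negligible [set t : R | ~ good_param t].
Proof.
pose Bad k L := \bigcup_N exceed _ (measurableTypeR R) R (@gauss R) (gauss_weight R L) (k.+1%:R^-1) N.
have mBad k L : measurable (Bad k L).
  apply: bigcup_measurable => N _; apply: measurable_exceed.
  - exact: measurable_gauss.
  - exact: measurable_gauss_weight.
have Bad0 k : mu.-negligible (\bigcap_L Bad k L).
  exists (\bigcap_L Bad k L); split => //; first by apply: bigcap_measurable => //; exists 0%N.
  apply/eqP; rewrite eq_le measure_ge0 andbT; apply/lee_addgt0Pr => e e0; rewrite add0e.
  have [L hL] : exists L, (\int[mu]_x (gauss_weight R L x)%:E < (k.+1%:R^-1 * e)%:E)%E.
    by apply: tail_small; rewrite mulr_gt0.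
  apply: (@le_trans _ _ (mu (Bad k L))).
    apply: le_measure; rewrite ?inE //; first by apply: bigcap_measurable => //; exists 0%N.
    by move=> x; apply.
  have k0 : 0 < k.+1%:R^-1 :> R by rewrite invr_gt0.
  have := @maximal_inequality_union _ _ R mu (@gauss R) (gauss_weight R L)
    (measurable_gauss R) gauss_invariant (measurable_gauss_weight R L) (gauss_weight_ge0 R L) _ k0.
  move=> /le_lt_trans/(_ hL); rewrite EFinM => h.
  by move: (ltW h); rewrite lee_pmul2l // lte_fin.
have m0 : mu.-negligible (~` `]0, 1]%classic).
  exists (~` `]0, 1]%classic); split => //; first by apply: measurableC; exact: measurable_itv.
  by rewrite probability_setC // [X in (_ - X)%E]mu01 subee.
have mit i : measurable_fun setT (iter i (@gauss R)).
  by elim: i => [|i IH] /=; [exact: measurable_id | exact: measurableT_comp (measurable_gauss R) IH].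
have rat0 i : mu.-negligible (iter i (@gauss R) @^-1` [set 0]).
  have m1 : measurable ([set 0] : set R) by exact: measurable_set1.
  have mi j : measurable (iter j (@gauss R) @^-1` [set 0]).
    by have := mit j measurableT _ m1; rewrite setTI.
  exists (iter i (@gauss R) @^-1` [set 0]); split; [exact: mi | | by []].
  elim: i => [|i IH]; last first.
    rewrite -IH -(gauss_invariant _ (mi i)); congr (mu _).
    by apply/seteqP; split => x; rewrite /preimage /= -iterS iterSr.
  apply/eqP; rewrite eq_le measure_ge0 andbT.
  rewrite -[leRHS](_ : mu (~` `]0, 1]%classic) = 0%E); last first.
    by rewrite probability_setC // [X in (_ - X)%E]mu01 subee.
  apply: le_measure; rewrite ?inE.
  - exact: (mi 0%N).
  - by apply: measurableC; exact: measurable_itv.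
  by move=> x /= ->; rewrite in_itv /= ltxx.
apply: negligibleS (negligibleU (negligible_bigcup Bad0)
  (negligibleU m0 (negligible_bigcup rat0))) => t ngood.
have [t01|t01] := pselect (`]0, 1]%classic t); last by right; left.
have t01' : t \in `[0, 1] by move: t01; rewrite /= !in_itv /= => /andP[/ltW -> ->].
have [trat|tirr] := pselect (is_rational t).
  by right; right; have [i hi] := rational_gauss0 R t t01' trat; exists i.
left; apply: contrapT => nBad; apply: ngood.
apply: weight_digit_good => // eps e0.
pose k := Num.truncn (2 / eps).
have hk : k.+1%:R^-1 <= eps / 2.
  have /andP[_ h2] := @truncn_itv _ (2 / eps) ltac:(by rewrite divr_ge0 // ltW).
  rewrite -[leRHS]invrK lef_pV2 ?posrE ?invr_gt0 ?divr_gt0 // invf_div.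
  exact: ltW.
have [L hL] : exists L, ~ Bad k L t.
  apply: contrapT => /forallNP h; apply: nBad; exists k => // L _.
  by have /contrapT := h L.
exists L, 1%N => M M1.
(* Digit [m + 1] is read from iterate [m]. Adding iterate 0 makes [M + 1 <= 2 M] terms, which the
   choice of [eps / 2] absorbs. *)
apply: (@le_trans _ _ (\sum_(0 <= i < M.+1) gauss_weight R L (iter i (@gauss R) t))).
  rewrite [leRHS]big_ltn //= lerDr; exact: gauss_weight_ge0.
apply: (@le_trans _ _ (k.+1%:R^-1 * M.+1%:R)).
  rewrite leNgt; apply/negP => hM; apply: hL; exists M.+1 => //; exists M.+1 => //.
  by rewrite leqnn.
apply: (@le_trans _ _ (eps / 2 * (2 * M%:R))); last by lra.
apply: ler_pM => //; rewrite -natrM ler_nat; lia.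
Qed.

End GaussErgodic.

(** * Lebesgue-typical digits *)

Section LebesgueDigits.
Variable R : realType.
Local Notation mu := (@lebesgue_measure R).

Lemma countable_rational : countable [set t : R | is_rational t].
Proof.
rewrite (_ : [set t : R | _] = range (ratr : rat -> R)); last first.
  by apply/seteqP; split => [_ [r ->]|_ [r _ <-]]; exists r.
exact: (card_le_trans (card_image_le _ _) (countableP _)).
Qed.

Lemma measurable_rational : measurable [set t : R | is_rational t].
Proof. by apply: countable_measurable countable_rational => t; exact: measurable_set1. Qed.

(* The factor [ln 2 / 2] makes the exponential moment a square root, which is
   summable against the cylinder lengths of order [k^-2]. *)
Lemma expR_weight L k : expR (ln 2 / 2 * weight R L k) =
  if (L <= k.+1)%N then Num.sqrt k.+1%:R else 1 :> R.
Proof.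
rewrite /weight; case: ifP => _; last by rewrite mulr0 expR0.
have l2 : 0 < ln 2 :> R by rewrite ln_gt0 // ltr1n.
rewrite /log2 (_ : ln 2 / 2 * _ = 2^-1 * ln k.+1%:R); last by field; rewrite gt_eqF.
by rewrite -powR12_sqrt // /powR pnatr_eq0.
Qed.

Definition digit_excess L M (c : R) : set R :=
  [set x | [/\ 0 < x < 1, ~ is_rational x &
     c < \sum_(0 <= i < M) gauss_weight R L (iter i (@gauss R) x)]].

Lemma measurable_digit_excess L M c : measurable (digit_excess L M c).
Proof.
have mit i : measurable_fun setT (iter i (@gauss R)).
  by elim: i => [|i IH] /=; [exact: measurable_id | exact: measurableT_comp (measurable_gauss R) IH].
have mS : measurable_fun setT (fun x => \sum_(0 <= i < M) gauss_weight R L (iter i (@gauss R) x)).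
  by apply: measurable_sum => i; exact: measurableT_comp (measurable_gauss_weight R L) (mit i).
rewrite (_ : digit_excess L M c = `]0, 1[%classic `&` (~` [set t | is_rational t]) `&`
  ((fun x => \sum_(0 <= i < M) gauss_weight R L (iter i (@gauss R) x)) @^-1` `]c, +oo[%classic)).
  apply: measurableI; first by apply: measurableI => //; apply: measurableC; exact: measurable_rational.
  by rewrite -[X in measurable X]setTI; apply: mS => //; exact: measurable_itv.
apply/seteqP; split => x /=; rewrite !in_itv /= andbT; first by case.
by move=> [[]].
Qed.

(* The inverse of [x |-> (p + p' x) / (q + q' x)], which maps ]0, 1[ onto the
   cylinder with consecutive convergents [p'/q'] and [p/q]. *)
Definition moebius (q' q p' p t : R) : R := (p - q * t) / (q' * t - p').

Definition cylinder_excess L M (q' q p' p c : R) : set R :=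
  [set t | digit_excess L M c (moebius q' q p' p t)].

Lemma measurable_cylinder_excess L M q' q p' p c :
  measurable (cylinder_excess L M q' q p' p c).
Proof.
have mm : measurable_fun setT (moebius q' q p' p).
  apply: measurable_funM.
    by apply: measurable_funB => //; apply: measurable_funM.
  apply: measurableT_comp (measurable_inv R) _.
  by apply: measurable_funB => //; apply: measurable_funM.
by have := mm measurableT _ (measurable_digit_excess L M c); rewrite setTI.
Qed.

(** For [c >= 0] the empty sum does not exceed [c]. For [c < 0] the exponential is at least 1, and
    the set lies in the cylinder, of length [1 / (q (q + q'))], on the side of [p / q] given by the
    sign of the determinant. *)
Lemma cylinder_excess0 L q' q p' p c : 0 < q -> 0 <= q' ->
  (p' * q - p * q' = 1 \/ p' * q - p * q' = -1) ->
  (mu (cylinder_excess L 0 q' q p' p c) <= ((q * (q + q'))^-1 * expR (- (ln 2 / 2 * c)))%:E)%E.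
Proof.
move=> q0 q'0 det.
have [c0|c0] := leP 0 c.
  rewrite (_ : cylinder_excess _ _ _ _ _ _ _ = set0) ?measure0.
    by rewrite lee_fin mulr_ge0 ?expR_ge0 // invr_ge0 mulr_ge0 ?addr_ge0 // ltW.
  apply/seteqP; split => // t [_ _]; rewrite big_geq //.
  by move=> /(le_lt_trans c0); rewrite ltxx.
have qq : 0 < q + q' by rewrite ltr_wpDr.
pose len := (q * (q + q'))^-1.
have len0 : 0 < len by rewrite invr_gt0 mulr_gt0.
pose a := if p' * q - p * q' == 1 then p / q else p / q - len.
apply: (@le_trans _ _ len%:E); last first.
  rewrite lee_fin ler_peMr ?(ltW len0) // -[leLHS]expR0 ler_expR oppr_ge0.
  have l2 : 0 <= ln 2 / 2 :> R by rewrite divr_ge0 ?ln_ge0 ?ler1n.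
  by rewrite mulr_ge0_le0 // ltW.
apply: (@le_trans _ _ (mu `[a, a + len]%classic)); last first.
  rewrite lebesgue_measure_itv /= lte_fin ltrDl len0 -EFinD lee_fin; lra.
apply: le_measure; rewrite ?inE.
- exact: measurable_cylinder_excess.
- exact: measurable_itv.
move=> t [/andP[x0 x1] _ _]; rewrite /= in_itv /=.
set x := moebius _ _ _ _ _ in x0 x1.
have den : q' * t - p' != 0.
  by apply/eqP => h; move: x0; rewrite /x /moebius h invr0 mulr0 ltxx.
have hx : p - q * t = x * (q' * t - p') by rewrite /x /moebius divfK.
have qx : 0 < q + q' * x by rewrite ltr_wpDr // mulr_ge0 // ltW.
have tE : t - p / q = (p' * q - p * q') * (x / (q * (q + q' * x))).
  have -> : t = (p + p' * x) / (q + q' * x).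
    have qxn : q + q' * x != 0 by rewrite gt_eqF.
    by apply: (mulIf qxn); rewrite divfK //; lra.
  by field; rewrite !gt_eqF.
have y0 : 0 <= x / (q * (q + q' * x)) := divr_ge0 (ltW x0) (mulr_ge0 (ltW q0) (ltW qx)).
have y1 : x / (q * (q + q' * x)) <= len.
  rewrite /len ler_pdivrMr ?mulr_gt0 // mulrC ler_pdivlMr ?mulr_gt0 //.
  by nra.
rewrite /a; case: det => det; rewrite det in tE *.
  by rewrite eqxx; apply/andP; split; lra.
rewrite (_ : (-1 == 1 :> R) = false); last by apply/eqP; lra.
by apply/andP; split; lra.
Qed.

Lemma moebius_gauss q' q p' p t (k : nat) : moebius q' q p' p t != 0 ->
  moebius q (k%:R * q + q') p (k%:R * p + p') t = (moebius q' q p' p t)^-1 - k%:R.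
Proof.
rewrite /moebius mulf_eq0 invr_eq0 negb_or => /andP[h1 h2].
rewrite invf_div.
have h3 : q * t - p != 0 by rewrite -opprB oppr_eq0.
by field; rewrite h1 h3.
Qed.

Lemma cylinder_excess_sub L M q' q p' p c :
  cylinder_excess L M.+1 q' q p' p c `<=` \bigcup_k
    cylinder_excess L M q (k.+1%:R * q + q') p (k.+1%:R * p + p') (c - weight R L k.+1).
Proof.
move=> t [/andP[x0 x1] xirr hs].
set x := moebius _ _ _ _ _ in x0 x1 xirr hs.
have hx : 1 <= x^-1 by rewrite invf_ge1 // ltW.
have hx0 := le_trans ler01 hx.
have : (0 < Num.truncn x^-1)%N by rewrite truncn_gt0.
case kE : (Num.truncn x^-1) => [//|k] _; exists k => //.
have xk : moebius q (k.+1%:R * q + q') p (k.+1%:R * p + p') t = gauss x.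
  rewrite moebius_gauss ?gt_eqF // -/x /gauss; congr (_ - _).
  by rewrite -kE truncn_floor hx0 natr_absz ger0_norm ?floor_ge0.
have girr : ~ is_rational (gauss x) by move=> /gauss_rational.
rewrite /cylinder_excess /digit_excess /= xk; split => //.
  have /andP[g0 g1] := gauss_itv R x.
  rewrite g1 andbT lt_neqAle g0 andbT eq_sym; apply/eqP => g.
  by apply: girr; rewrite g; exact: (is_rational_int R 0).
rewrite big_ltn // big_add1 [_.-1]/= [X in X + _]/(gauss_weight _ _ _) /= in hs.
rewrite {1}/gauss_weight kE in hs.
rewrite ltrBlDl; apply: lt_le_trans hs _; rewrite lerD2l.
by rewrite le_eqVlt; apply/orP; left; apply/eqP/eq_bigr => i _; rewrite -iterS iterSr.
Qed.

(** The lengths of the subcylinders telescope to that of the parent. Where the square root enters,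
    length times root is at most [4 / (q (q + q'))] times [(k + 2) ^ (-3/2)]: one factor 2 from
    [k + 2 <= 2 (k + 1)], one from [q' <= q]. *)
Lemma sum_cylinder_lengths (q' q : R) (I0 X : nat) : (1 <= I0)%N -> 0 < q -> 0 <= q' -> q' <= q ->
  \sum_(0 <= k < X) ((k.+1%:R * q + q') * ((k.+1%:R * q + q') + q))^-1 *
     (if (I0.+1 <= k.+2)%N then Num.sqrt k.+2%:R else 1) <=
  (q * (q + q'))^-1 * (1 + 8 * (Num.sqrt I0%:R)^-1).
Proof.
move=> I01 q0 q'0 q'q.
have D0 (k : nat) : (0 < k)%N -> 0 < k%:R * q + q' by move=> k0; rewrite ltr_wpDr // mulr_gt0 // ltr0n.
have tele : \sum_(0 <= k < X) ((k.+1%:R * q + q') * ((k.+1%:R * q + q') + q))^-1 <= (q * (q + q'))^-1.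
  suff -> : \sum_(0 <= k < X) ((k.+1%:R * q + q') * ((k.+1%:R * q + q') + q))^-1 =
     q^-1 * ((q + q')^-1 - (X.+1%:R * q + q')^-1).
    rewrite invfM ler_pM2l ?invr_gt0 // gerBl invr_ge0 ltW // D0 //.
  elim: X => [|X IH]; first by rewrite big_geq // mul1r subrr mulr0.
  rewrite big_nat_recr //= IH.
  have -> : X.+2%:R * q + q' = (X.+1%:R * q + q') + q by rewrite -[X.+2%:R]natr1; ring.
  have h1 := D0 X.+1 isT; have h2 : 0 < q + q' by rewrite ltr_wpDr.
  have h3 := addr_gt0 h1 q0.
  by move: (X.+1%:R * q + q') h1 h3 => y h1 h3; field; rewrite !gt_eqF.
rewrite mulrDr mulr1.
pose f (i : nat) : R := if (I0 < i)%N then (Num.sqrt (i%:R : R) ^+ 3)^-1 else 0.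
apply: (@le_trans _ _ (\sum_(0 <= k < X) (((k.+1%:R * q + q') * ((k.+1%:R * q + q') + q))^-1 +
   4 * (q * (q + q'))^-1 * f k.+2))).
  apply: ler_sum => k _; rewrite /f; case: ifP => hk; last by rewrite mulr1 mulr0 addr0.
  apply: le_trans (_ : 4 * (q * (q + q'))^-1 * (Num.sqrt (k.+2%:R : R) ^+ 3)^-1 <= _); last first.
    have y0 := D0 k.+1 isT.
    by rewrite lerDr ltW // invr_gt0 mulr_gt0 // addr_gt0.
  set b := Num.sqrt _.
  have b0 : 0 < b by rewrite sqrtr_gt0.
  have bb : b ^+ 2 = k.+2%:R by rewrite sqr_sqrtr.
  have h1 : k.+1%:R * q <= k.+1%:R * q + q' by rewrite lerDl.
  have h2 : k.+2%:R * q <= (k.+1%:R * q + q') + q by rewrite -[k.+2%:R]natr1; lra.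
  have kq : 0 < k.+1%:R * q by rewrite mulr_gt0.
  have kq2 : 0 < k.+2%:R * q by rewrite mulr_gt0.
  have h3 : ((k.+1%:R * q + q') * ((k.+1%:R * q + q') + q))^-1 <= ((k.+1%:R * q) * (k.+2%:R * q))^-1.
    rewrite lef_pV2 ?posrE ?mulr_gt0 //; first by apply: ler_pM => //; exact: ltW.
      exact: lt_le_trans kq h1.
    exact: lt_le_trans kq2 h2.
  apply: le_trans (ler_wpM2r (ltW b0) h3) _.
  have h4 : (k.+1%:R * q * (k.+2%:R * q))^-1 <= 2 * (q ^+ 2 * b ^+ 4)^-1.
    have -> : b ^+ 4 = k.+2%:R * k.+2%:R by rewrite (exprM _ 2 2) bb.
    rewrite -[leRHS]mulrC ler_pdivlMl ?mulr_gt0 ?exprn_gt0 //.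
    rewrite mulrC ler_pdivrMl ?mulr_gt0 //.
    have : k.+2%:R <= 2 * k.+1%:R :> R by rewrite -natrM ler_nat; lia.
    move: (k.+2%:R : R) (k.+1%:R : R) kq kq2 => u v kq kq2 uv.
    have uv0 : 0 <= 2 * v - u by lra.
    have := mulr_ge0 (mulr_ge0 (ltW q0) (ltW kq2)) uv0.
    by lra.
  apply: le_trans (ler_wpM2r (ltW b0) h4) _.
  rewrite (_ : 2 * _ * b = 2 * (q ^+ 2)^-1 * (b ^+ 3)^-1); last by field; rewrite !gt_eqF.
  rewrite ler_pM2r ?invr_gt0 ?exprn_gt0 //.
  rewrite (_ : 4 * _ = 2 * (2 * (q * (q + q'))^-1)); last by ring.
  have qq : q * q' <= q * q by rewrite ler_pM2l.
  rewrite ler_pM2l // [leRHS]mulrC ler_pdivlMl ?mulr_gt0 ?ltr_wpDr //.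
  by rewrite ler_pdivrMr ?exprn_gt0 // expr2; lra.
rewrite big_split /= -mulr_sumr; apply: lerD => //.
have -> : (q * (q + q'))^-1 * (8 * (Num.sqrt I0%:R)^-1) =
   4 * (q * (q + q'))^-1 * (2 * (Num.sqrt I0%:R)^-1) by ring.
apply: ler_wpM2l; first by rewrite mulr_ge0 // invr_ge0 mulr_ge0 ?addr_ge0 // ltW.
apply: le_trans (sum_inv_cube_le R I0 X.+2 I01).
rewrite [leRHS]big_ltn // [X in _ <= _ + X]big_ltn // !big_add1 /=.
rewrite addrA lerDr addr_ge0 //; case: ifP => // _; by rewrite invr_ge0 exprn_ge0 // sqrtr_ge0.
Qed.

(** A Chernoff bound taken digit by digit. Digits are not independent, but [sum_cylinder_lengths]
    bounds the conditional moment by [1 + 8 / sqrt I0] uniformly over cylinders; hence the induction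
    over arbitrary [q', q, p', p, c]. *)
Lemma cylinder_excess_le (I0 M : nat) : (1 <= I0)%N -> forall q' q p' p c,
  0 < q -> 0 <= q' -> q' <= q ->
  (p' * q - p * q' = 1 \/ p' * q - p * q' = -1) ->
  (mu (cylinder_excess I0.+1 M q' q p' p c) <=
    ((q * (q + q'))^-1 * (1 + 8 * (Num.sqrt I0%:R)^-1) ^+ M * expR (- (ln 2 / 2 * c)))%:E)%E.
Proof.
move=> I01; elim: M => [|M IH] q' q p' p c q0 q'0 q'q det.
  by rewrite expr0 mulr1; exact: cylinder_excess0.
set d := 1 + _ in IH *.
have d0 : 0 <= d by rewrite addr_ge0 // mulr_ge0 // invr_ge0 sqrtr_ge0.
pose F k := cylinder_excess I0.+1 M q (k.+1%:R * q + q') p (k.+1%:R * p + p')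
  (c - weight R I0.+1 k.+1).
have mF k : measurable (F k) by exact: measurable_cylinder_excess.
have mA := measurable_cylinder_excess I0.+1 M.+1 q' q p' p c.
have sub := cylinder_excess_sub I0.+1 M q' q p' p c.
apply: le_trans (measure_sigma_subadditive mu mF mA sub) _.
apply: nneseries_le_bound => [k|X]; first exact: measure_ge0.
apply: (@le_trans _ _ (\sum_(0 <= k < X) (((k.+1%:R * q + q') * ((k.+1%:R * q + q') + q))^-1 *
   d ^+ M * expR (- (ln 2 / 2 * (c - weight R I0.+1 k.+1))))%:E)%E).
  apply: lee_sum => k _; apply: IH => //.
  - by rewrite ltr_wpDr // mulr_gt0.
  - exact: ltW.
  - by rewrite -[k.+1%:R]natr1 mulrDl mul1r -addrA [_ + q']addrC addrA lerDr addr_ge0 // mulr_ge0 // ltW.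
  - rewrite (_ : _ - _ = - (p' * q - p * q')); last by ring.
    by case: det => ->; [right | left; rewrite opprK].
rewrite sumEFin lee_fin.
rewrite (eq_bigr (fun k => (((k.+1%:R * q + q') * ((k.+1%:R * q + q') + q))^-1 *
  (if (I0.+1 <= k.+2)%N then Num.sqrt k.+2%:R else 1)) * (d ^+ M * expR (- (ln 2 / 2 * c))))); last first.
  move=> k _; rewrite -expR_weight mulrBr opprB expRD; ring.
rewrite -mulr_suml exprS.
apply: le_trans (ler_wpM2r _ (sum_cylinder_lengths q' q I0 X I01 q0 q'0 q'q)) _.
  by rewrite mulr_ge0 ?exprn_ge0 ?expR_ge0.
by rewrite -/d le_eqVlt; apply/orP; left; apply/eqP; ring.
Qed.

Lemma digit_excess_le (I0 M : nat) c : (1 <= I0)%N ->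
  (mu (digit_excess I0.+1 M c) <=
    ((1 + 8 * (Num.sqrt I0%:R)^-1) ^+ M * expR (- (ln 2 / 2 * c)))%:E)%E.
Proof.
move=> I01.
(* [0, 1, 1, 0] is the cylinder of no digits, on which [moebius] is the identity. *)
have := cylinder_excess_le I0 M I01 0 1 1 0 c ltr01 (lexx 0) ler01 (or_introl _).
rewrite mulr0 subr0 mul1r => /(_ erefl).
rewrite addr0 mul1r invr1 mul1r.
rewrite (_ : cylinder_excess _ _ _ _ _ _ _ = digit_excess I0.+1 M c) //.
apply/seteqP; split => x; rewrite /cylinder_excess /= /moebius mul0r mul1r !sub0r;
  by rewrite invrN invr1 mulrN1 opprK.
Qed.

Lemma excess_limsup_null (eps : R) : 0 < eps -> exists L,
  mu (lim_sup_set (fun M => digit_excess L M (eps * M%:R))) = 0%E.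
Proof.
move=> e0; pose th : R := ln 2 / 2.
have th0 : 0 < th by rewrite divr_gt0 // ln_gt0 // ltr1n.
have te0 : 0 < th * eps / 2 by rewrite divr_gt0 // mulr_gt0.
(* Such an [I0] leaves growth at most [expR (th eps M / 2)] against decay [expR (- th eps M)], so a
   geometric series remains. *)
pose I0 := (Num.truncn ((8 / (th * eps / 2)) ^+ 2)).+1.
have hI : 8 * (Num.sqrt I0%:R)^-1 <= th * eps / 2.
  have /andP[_ /ltW h] := truncn_itv (sqr_ge0 (8 / (th * eps / 2))); rewrite -/I0 in h.
  have h8 : 0 <= 8 / (th * eps / 2) by rewrite divr_ge0 // ltW.
  have : 8 / (th * eps / 2) <= Num.sqrt I0%:R.
    by rewrite -[leLHS](ger0_norm h8) -sqrtr_sqr ler_wsqrtr.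
  by rewrite ler_pdivrMr // ler_pdivrMr ?sqrtr_gt0 ?ltr0n // mulrC.
exists I0.+1; apply: lim_sup_set_cvg0 => [M|]; first exact: measurable_digit_excess.
pose r := expR (- (th * eps / 2)).
have r0 : 0 < r by exact: expR_gt0.
have r1 : r < 1 by rewrite -expR0 ltr_expR oppr_lt0.
apply: (@le_lt_trans _ _ ((1 - r)^-1)%:E); last exact: ltry.
apply: nneseries_le_bound => [n|X]; first exact: measure_ge0.
apply: (@le_trans _ _ (\sum_(0 <= M < X) (r ^+ M)%:E)%E).
  apply: lee_sum => M _; apply: le_trans (digit_excess_le I0 M _ isT) _.
  rewrite lee_fin -/th.
  have h1 : (1 + 8 * (Num.sqrt I0%:R)^-1) ^+ M <= expR (th * eps / 2) ^+ M.
    have d0 : 0 <= 1 + 8 * (Num.sqrt (I0%:R : R))^-1.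
      by rewrite addr_ge0 // mulr_ge0 // invr_ge0 sqrtr_ge0.
    rewrite lerXn2r ?nnegrE ?d0 ?expR_ge0 //.
    by apply: le_trans (expR_ge1Dx _); rewrite lerD2l.
  apply: le_trans (ler_wpM2r (expR_ge0 _) h1) _.
  rewrite /r -!expRM_natl -expRD ler_expR; lra.
rewrite sumEFin lee_fin.
have : \sum_(0 <= M < X) r ^+ M = (1 - r ^+ X) / (1 - r).
  elim: X => [|X IH]; first by rewrite big_geq // expr0 subrr mul0r.
  have h : 1 - r != 0 by rewrite subr_eq0 gt_eqF.
  by rewrite big_nat_recr //= IH exprS; field.
move=> ->; rewrite ler_pdivrMr ?subr_gt0 // mulVf ?subr_eq0 ?gt_eqF //.
by rewrite gerBl exprn_ge0 // ltW.
Qed.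

Lemma lebesgue_ae_good : mu.-negligible [set t : R | t \in `[0, 1] /\ ~ good_param t].
Proof.
have /choice[L HL] : forall k : nat, exists L,
    mu (lim_sup_set (fun M => digit_excess L M (k.+1%:R^-1 * M%:R))) = 0%E.
  by move=> k; apply: excess_limsup_null; rewrite invr_gt0.
pose Bad k := lim_sup_set (fun M => digit_excess (L k) M (k.+1%:R^-1 * M%:R)).
have Bad0 k : mu.-negligible (Bad k).
  exists (Bad k); split; [|exact: HL|by []].
  apply: bigcap_measurable => [|n _]; first by exists 0%N.
  by apply: bigcup_measurable => i _; exact: measurable_digit_excess.
have rat0 : mu.-negligible [set t : R | is_rational t].
  exists [set t : R | is_rational t]; split => //; first exact: measurable_rational.
  exact: countable_lebesgue_measure0 countable_rational.
apply: negligibleS (negligibleU rat0 (negligible_bigcup Bad0)) => t [t01 ngood].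
have [trat|tirr] := pselect (is_rational t); [by left|right].
apply: contrapT => nBad; apply: ngood; apply: weight_digit_good => // eps e0.
pose k := Num.truncn (2 / eps).
have hk : k.+1%:R^-1 <= eps / 2.
  have /andP[_ h2] := @truncn_itv _ (2 / eps) ltac:(by rewrite divr_ge0 // ltW).
  rewrite -[leRHS]invrK lef_pV2 ?posrE ?invr_gt0 ?divr_gt0 // invf_div.
  exact: ltW.
have [N hN] : exists N, forall M, (N <= M)%N -> ~ digit_excess (L k) M (k.+1%:R^-1 * M%:R) t.
  apply: contrapT => /forallNP h; apply: nBad; exists k => // N _.
  have /existsNP[M hM] := h N; have /not_implyP[NM /contrapT hM'] := hM.
  by exists M.
(* [N.+1] also gives [M >= 1], hence [M + 1 <= 2 M]. *)
exists (L k), N.+1 => M NM.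
apply: (@le_trans _ _ (\sum_(0 <= i < M.+1) gauss_weight R (L k) (iter i (@gauss R) t))).
  rewrite [leRHS]big_ltn //= lerDr; exact: gauss_weight_ge0.
apply: (@le_trans _ _ (k.+1%:R^-1 * M.+1%:R)).
  rewrite leNgt; apply/negP => hM; apply: (hN M.+1); first by lia.
  by split => //; exact: (iter_gauss_itv R t t01 tirr 0).
apply: (@le_trans _ _ (eps / 2 * (2 * M%:R))); last by lra.
apply: ler_pM => //; rewrite -natrM ler_nat; lia.
Qed.

End LebesgueDigits.

Theorem mainTheorem5 (R : realType) :
  (* 1. rational t *)
  (forall t : R, t \in `[0, 1] -> is_rational t ->
     exact_overlap t /\
     (forall z : R, z \in `[0, 1 + t] ->
        (hausdorff_dim (U t z (fun=> 1%R)) < 1%:E)%E)) /\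
  (* 2. irrational t *)
  (forall t : R, t \in `[0, 1] -> ~ is_rational t ->
     exists h : nat -> R, (forall n, 0 <= h n) /\ h @ \oo --> (0 : R) /\
       (forall z : R, z \in `[0, 1 + t] -> ae_in_U t z h)) /\
  (* 3. badly approximable t *)
  (forall t : R, t \in `[0, 1] -> badly_approximable t ->
     forall z : R, z \in `[0, 1 + t] ->
     forall h : nat -> R, (forall n, 0 <= h n) ->
       (\sum_(1 <= n <oo) (h n)%:E)%E = +oo%E -> ae_in_U t z h) /\
  (* 4. irrational, not badly approximable t *)
  (forall t : R, t \in `[0, 1] -> ~ is_rational t -> ~ badly_approximable t ->
     exists h : nat -> R, (forall n, 0 <= h n) /\
       (\sum_(1 <= n <oo) (h n)%:E)%E = +oo%E /\
       (forall z : R, z \in `[0, 1 + t] ->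
          (@lebesgue_measure R).-negligible (U t z h))) /\
  (* 5. digit condition *)
  (forall t : R, t \in `[0, 1] -> ~ is_rational t ->
     (forall eps : R, 0 < eps -> exists L : nat,
        \forall M \near \oo,
          \sum_(1 <= m < M.+1 | (L%:R : R) <= (cf_q t m.+1)%:R / (cf_q t m)%:R)
              log2 ((cf_digit t m.+1)%:R + 1) <= eps * M%:R) ->
     good_param t) /\
  (* 6. Gauss-ergodic measures *)
  (forall mu : probability (measurableTypeR R) R,
     gauss_ergodic_invariant mu ->
     (\sum_(1 <= m <oo)
        (mu `[(m.+1%:R)^-1%R, (m%:R)^-1%R]%classic * (log2 m.+1%:R)%:E) < +oo)%E ->
     mu.-negligible [set t : R | ~ good_param t]) /\
  (* in particular, Lebesgue-a.e. t in [0,1] *)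
  (@lebesgue_measure R).-negligible [set t : R | t \in `[0, 1] /\ ~ good_param t].
Proof.
split; first by move=> t t01 trat; split; [exact: rational_exact_overlap | exact: rational_dim_lt1].
split; first by move=> t t01 tirr; exact: irrational_vanishing_full.
split.
  move=> t t01 tbad z zt h h0 hoo.
  exact: (badly_approximable_full R t t01 tbad.1 z h tbad zt h0 hoo).
split; first by move=> t t01 tirr nba; exact: not_badly_approximable_null.
split; first by move=> t t01 tirr dc; exact: digit_condition_good.
split; last exact: lebesgue_ae_good.
by move=> mu [mu01 [muinv _]] musum; exact: (gauss_good R mu mu01 muinv musum).
Qed.
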